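(* Let $\varsigma,\tau,\delta\in\mathbb{T}$ with $|\operatorname{Im}_j(\varsigma)|<\operatorname{Re}(\varsigma)$ and $|\operatorname{Im}_j(\tau)|<\operatorname{Re}(\tau)$, let $a=u_1+j\,u_4$ ($u_1,u_4\in\mathbb{R}$) be a hyperbolic number with $u_1>|u_4|$, let $N_0$ be a constant, and let $n\in\mathbb{N}$. Then the solution of the equation $$N(t)-N_0\,t^{\tau-1}\,\mathbb{E}_{\varsigma,\tau}^{\delta}\left[-(at)^{\varsigma}\right]=-\sum_{r=1}^{n}\binom{n}{r}a^{r\varsigma}\;{}_0D_t^{-r\varsigma}N(t),\qquad t>0,$$ is given by $$N(t)=N_0\,t^{\tau-1}\,\mathbb{E}_{\varsigma,\tau}^{\delta+n}\left[-(at)^{\varsigma}\right].$$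
   Context: $\mathbb{T}=\{x_0+i_1x_1+i_2x_2+jx_3: x_0,\dots,x_3\in\mathbb{R}\}$ is the commutative algebra of bicomplex numbers, with $i_1^2=i_2^2=-1$, $j=i_1i_2=i_2i_1$, $j^2=1$; write $\operatorname{Re}=x_0$, $\operatorname{Im}_j=x_3$. Hyperbolic numbers are the elements $x_0+jx_3$, $x_0,x_3\in\mathbb{R}$. $\mathbb{C}$ is identified with $\{x_0+i_1x_1\}$. With $e_1=\frac{1+i_1i_2}{2}$, $e_2=\frac{1-i_1i_2}{2}$, every $\xi=w_1+i_2w_2$ ($w_1,w_2\in\mathbb{C}$) is uniquely $\xi=\xi_1e_1+\xi_2e_2$ with $\xi_1=w_1-i_1w_2$, $\xi_2=w_1+i_1w_2\in\mathbb{C}$; algebraic operations, limits, integrals over real $t$, $\Gamma$ and powers are componentwise, e.g. $\xi^{\eta}=\xi_1^{\eta_1}e_1+\xi_2^{\eta_2}e_2$. The components of $a$ are the positive reals $u_1+u_4$ and $u_1-u_4$, so $(at)^{\varsigma}$ and $a^{r\varsigma}$ are formed with powers of positive reals. The Riemann--Liouville fractional integral is ${}_0D_t^{-\nu}N(t)=\frac{1}{\Gamma(\nu)}\int_0^t(t-u)^{\nu-1}N(u)\,du$ (componentwise). The bicomplex Prabhakar function is $$\mathbb{E}_{\varsigma,\tau}^{\delta}(\zeta)=\sum_{k=0}^{\infty}\frac{(\delta)_k}{k!\,\Gamma(\varsigma k+\tau)}\zeta^k,\qquad (\delta)_k=\delta(\delta+1)\cdots(\delta+k-1),\ (\delta)_0=1.$$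 *)

(* Defs.v *)
From HB Require Import structures.
From mathcomp Require Import all_boot all_order all_algebra.
From mathcomp Require Import complex ring.
From mathcomp Require Import all_classical all_reals all_analysis.

Set Implicit Arguments.
Unset Strict Implicit.
Unset Printing Implicit Defensive.

Import Order.TTheory GRing.Theory Num.Theory.
Import numFieldNormedType.Exports.

Local Open Scope classical_set_scope.
Local Open Scope ring_scope.
Local Open Scope complex_scope.

(* [Bicomplex w1 w2] stands for w1 + i2 w2, with C(i1) = R[i].  Writing
   w1 = x0 + i1 x1 and w2 = x2 + i1 x3, this is x0 + i1 x1 + i2 x2 + j x3. *)
Record bicomplex (R : realType) := Bicomplex { bcw1 : R[i]; bcw2 : R[i] }.

Section Algebra.
Variable R : realType.
Notation T := (bicomplex R).
Implicit Types x y : T.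

Definition bc_pair x : R[i] * R[i] := (bcw1 x, bcw2 x).
Definition pair_bc (p : R[i] * R[i]) : T := Bicomplex p.1 p.2.

Lemma bc_pairK : cancel bc_pair pair_bc. Proof. by case. Qed.

HB.instance Definition _ := Equality.copy T (can_type bc_pairK).
HB.instance Definition _ := Choice.copy T (can_type bc_pairK).

Definition bc_add x y : T := Bicomplex (bcw1 x + bcw1 y) (bcw2 x + bcw2 y).
Definition bc_opp x : T := Bicomplex (- bcw1 x) (- bcw2 x).
Definition bc_mul x y : T :=
  Bicomplex (bcw1 x * bcw1 y - bcw2 x * bcw2 y)
            (bcw1 x * bcw2 y + bcw2 x * bcw1 y).
Definition bc_zero : T := Bicomplex 0 0.
Definition bc_one : T := Bicomplex 1 0.

Lemma bc_addA : associative bc_add.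
Proof. by move=> [a b] [c d] [e f]; rewrite /bc_add /= !addrA. Qed.
Lemma bc_addC : commutative bc_add.
Proof. by move=> [a b] [c d]; congr Bicomplex => /=; ring. Qed.
Lemma bc_add0 : left_id bc_zero bc_add.
Proof. by move=> [a b]; rewrite /bc_add /= !add0r. Qed.
Lemma bc_addN : left_inverse bc_zero bc_opp bc_add.
Proof. by move=> [a b]; rewrite /bc_add /= !addNr. Qed.

HB.instance Definition _ :=
  GRing.isZmodule.Build T bc_addA bc_addC bc_add0 bc_addN.

Lemma bc_mulA : associative bc_mul.
Proof. by move=> [a b] [c d] [e f]; congr Bicomplex => /=; ring. Qed.
Lemma bc_mulC : commutative bc_mul.
Proof. by move=> [a b] [c d]; congr Bicomplex => /=; ring. Qed.
Lemma bc_mul1 : left_id bc_one bc_mul.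
Proof. by move=> [a b]; congr Bicomplex => /=; ring. Qed.
Lemma bc_mulDl : left_distributive bc_mul +%R.
Proof. by move=> [a b] [c d] [e f]; congr Bicomplex => /=; ring. Qed.
Lemma bc_one_neq0 : bc_one != 0.
Proof. by apply/eqP => -[/eqP]; rewrite oner_eq0. Qed.

HB.instance Definition _ := GRing.Zmodule_isComNzRing.Build T
  bc_mulA bc_mulC bc_mul1 bc_mulDl bc_one_neq0.

Definition bc_real (r : R) : T := Bicomplex r%:C 0.
Definition bc_i1 : T := Bicomplex 'i%C 0.
Definition bc_i2 : T := Bicomplex 0 1.
Definition bc_j : T := bc_i1 * bc_i2.

Definition bcRe x : R := complex.Re (bcw1 x).
Definition bcImj x : R := complex.Im (bcw2 x).

Definition hyperbolic (x0 x3 : R) : T := bc_real x0 + bc_j * bc_real x3.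

Definition idem1 x : R[i] := bcw1 x - 'i%C * bcw2 x.
Definition idem2 x : R[i] := bcw1 x + 'i%C * bcw2 x.

(* z1 e1 + z2 e2 with e1 = (1 + i1 i2)/2 and e2 = (1 - i1 i2)/2 *)
Definition of_idem (z1 z2 : R[i]) : T :=
  Bicomplex ((z1 + z2) / 2) ('i%C * (z1 - z2) / 2).

Lemma sqr_i1 : 'i%C * 'i%C = -1 :> R[i].
Proof. by rewrite -expr2 sqr_i. Qed.

Lemma of_idemK1 z1 z2 : idem1 (of_idem z1 z2) = z1.
Proof.
rewrite /idem1 /= !mulrA sqr_i1.
by field.
Qed.

Lemma of_idemK2 z1 z2 : idem2 (of_idem z1 z2) = z2.
Proof.
rewrite /idem2 /= !mulrA sqr_i1.
by field.
Qed.

Lemma idemK x : of_idem (idem1 x) (idem2 x) = x.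
Proof.
case: x => a b; rewrite /of_idem /idem1 /idem2 /=; congr Bicomplex; first by field.
rewrite (_ : 'i%C * _ = - ('i%C * 'i%C) * (b * 2)); last by ring.
by rewrite sqr_i1; field.
Qed.

Lemma idem_inj x y : idem1 x = idem1 y -> idem2 x = idem2 y -> x = y.
Proof. by move=> e1 e2; rewrite -[x]idemK e1 e2 idemK. Qed.

Lemma idem1M x y : idem1 (x * y) = idem1 x * idem1 y.
Proof.
case: x y => [a b] [c d]; rewrite /idem1 /=.
have -> : (a - 'i%C * b) * (c - 'i%C * d) =
  a * c + 'i%C * 'i%C * (b * d) - 'i%C * (a * d + b * c) by ring.
by rewrite sqr_i1 mulN1r.
Qed.

Lemma idem2M x y : idem2 (x * y) = idem2 x * idem2 y.
Proof.
case: x y => [a b] [c d]; rewrite /idem2 /=.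
have -> : (a + 'i%C * b) * (c + 'i%C * d) =
  a * c + 'i%C * 'i%C * (b * d) + 'i%C * (a * d + b * c) by ring.
by rewrite sqr_i1 mulN1r.
Qed.

Lemma idem1_1 : idem1 1 = 1. Proof. by rewrite /idem1 /= mulr0 subr0. Qed.
Lemma idem2_1 : idem2 1 = 1. Proof. by rewrite /idem2 /= mulr0 addr0. Qed.

Lemma of_idemE z1 z2 : of_idem z1 z2 =
  Bicomplex z1 0 * (Bicomplex 2^-1 0 * (1 + bc_i1 * bc_i2)) +
  Bicomplex z2 0 * (Bicomplex 2^-1 0 * (1 - bc_i1 * bc_i2)).
Proof.
congr Bicomplex; rewrite /= ?mulr0 ?mul0r ?mulr1 ?subr0 ?addr0 ?add0r; by field.
Qed.

Lemma idem1_hyperbolic (x0 x3 : R) : idem1 (hyperbolic x0 x3) = (x0 + x3)%:C.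
Proof.
apply/eqP; rewrite eq_complex /=.
by apply/andP; split; apply/eqP; ring.
Qed.

Lemma idem2_hyperbolic (x0 x3 : R) : idem2 (hyperbolic x0 x3) = (x0 - x3)%:C.
Proof.
apply/eqP; rewrite eq_complex /=.
by apply/andP; split; apply/eqP; ring.
Qed.

(* The zero divisors are the numbers with a vanishing idempotent component;
   as usual in the library, non units are fixed by inversion. *)
Definition bc_unit : pred T := fun x => (idem1 x != 0) && (idem2 x != 0).
Definition bc_inv x : T :=
  if bc_unit x then of_idem (idem1 x)^-1 (idem2 x)^-1 else x.

Lemma bc_mulVr : {in bc_unit, left_inverse 1 bc_inv *%R}.
Proof.
move=> x ux; rewrite /bc_inv (ux : bc_unit x); case/andP: (ux : bc_unit x) => u1 u2.
by apply: idem_inj;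
  rewrite ?(idem1M, idem2M, of_idemK1, of_idemK2) mulVf // (idem1_1, idem2_1).
Qed.

Lemma bc_unitP x y : y * x = 1 -> bc_unit x.
Proof.
move=> yx1; apply/andP; split; apply/eqP => x0.
  by have := congr1 idem1 yx1; rewrite idem1M x0 mulr0 idem1_1 => /esym/eqP;
    rewrite oner_eq0.
by have := congr1 idem2 yx1; rewrite idem2M x0 mulr0 idem2_1 => /esym/eqP;
  rewrite oner_eq0.
Qed.

Lemma bc_inv_out : {in [predC bc_unit], bc_inv =1 id}.
Proof. by move=> x; rewrite inE /= /bc_inv => /negbTE nu; rewrite [bc_unit x]nu. Qed.

HB.instance Definition _ := GRing.ComNzRing_hasMulInverse.Build T
  bc_mulVr bc_unitP bc_inv_out.

End Algebra.

Section Analysis.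
Variable R : realType.
Notation T := (bicomplex R).
Notation mu := (@lebesgue_measure R).

(* p ^ z = exp (z ln p) for a positive real base p *)
Definition cpow (p : R) (z : R[i]) : R[i] :=
  (expR (complex.Re z * ln p))%:C *
  (cos (complex.Im z * ln p) +i* sin (complex.Im z * ln p)).

(* a ^ eta; only meaningful when both idempotent components of a are
   positive reals *)
Definition bcpow (a eta : T) : T :=
  of_idem (cpow (complex.Re (idem1 a)) (idem1 eta))
          (cpow (complex.Re (idem2 a)) (idem2 eta)).

Definition cintegrable (D : set R) (f : R -> R[i]) : Prop :=
  mu.-integrable D (fun x => (complex.Re (f x))%:E) /\
  mu.-integrable D (fun x => (complex.Im (f x))%:E).

Definition cintegral (D : set R) (f : R -> R[i]) : R[i] :=
  (\int[mu]_(x in D) complex.Re (f x)) +i* (\int[mu]_(x in D) complex.Im (f x)).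

Definition bcintegrable (D : set R) (f : R -> T) : Prop :=
  cintegrable D (fun x => idem1 (f x)) /\ cintegrable D (fun x => idem2 (f x)).

Definition bcintegral (D : set R) (f : R -> T) : T :=
  of_idem (cintegral D (fun x => idem1 (f x)))
          (cintegral D (fun x => idem2 (f x))).

Definition clim (u : nat -> R[i]) : R[i] :=
  limn (fun n => complex.Re (u n)) +i* limn (fun n => complex.Im (u n)).

Definition bclim (u : nat -> T) : T :=
  of_idem (clim (fun n => idem1 (u n))) (clim (fun n => idem2 (u n))).

(* Euler's integral: this is the Gamma function on the half-plane Re z > 0 only *)
Definition cGamma (z : R[i]) : R[i] :=
  cintegral `]0, +oo[ (fun t => cpow t (z - 1) * (expR (- t))%:C).

Definition bcGamma (x : T) : T := of_idem (cGamma (idem1 x)) (cGamma (idem2 x)).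

Definition pochhammer (delta : T) (k : nat) : T :=
  \prod_(i < k) (delta + i%:R).

Definition prabhakar (sigma tau delta zeta : T) : T :=
  bclim (fun n => \sum_(0 <= k < n)
    pochhammer delta k / (k`!%:R * bcGamma (sigma * k%:R + tau)) * zeta ^+ k).

Definition RL_kernel (nu : T) (N : R -> T) (t u : R) : T :=
  bcpow (bc_real (t - u)) (nu - 1) * N u.

Definition RL_integrable (nu : T) (N : R -> T) (t : R) : Prop :=
  bcintegrable `]0, t[ (RL_kernel nu N t).

Definition RL_integral (nu : T) (N : R -> T) (t : R) : T :=
  (bcGamma nu)^-1 * bcintegral `]0, t[ (RL_kernel nu N t).

(* N0 t^(tau - 1) E_{sigma,tau}^delta [- (a t)^sigma] *)
Definition kinetic_term (sigma tau delta a N0 : T) (t : R) : T :=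
  N0 * bcpow (bc_real t) (tau - 1) *
    prabhakar sigma tau delta (- bcpow (a * bc_real t) sigma).

(* The Lebesgue integral of a non integrable function has a junk value in the
   library, so a solution is required to make every fractional integral of the
   equation absolutely convergent. *)
Definition kinetic_solution (sigma tau delta a N0 : T) (n : nat)
    (N : R -> T) : Prop :=
  forall t : R, 0 < t ->
    (forall r, (1 <= r <= n)%N -> RL_integrable (r%:R * sigma) N t) /\
    N t - kinetic_term sigma tau delta a N0 t =
      - \sum_(1 <= r < n.+1)
          'C(n, r)%:R * bcpow a (r%:R * sigma) * RL_integral (r%:R * sigma) N t.

End Analysis.

(* Main.v *)
(* The equation decouples into its idempotent components, over C with a base p > 0.
   For Re z, Re w > 0, Fubini and scaling give the convolution rule
     x^(z-1) * x^(w-1) = B(z,w) x^(z+w-1)   and   Gamma(z) Gamma(w) = B(z,w) Gamma(z+w).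
   Existence: J^(r s) acts termwise on the series of
     F = sum_k (-b)^k (delta+n)_k / k! t^(s k+tau-1) / Gamma(s k+tau),  b = p^s,
   by shifting the exponents, and the sum of the equation collapses because
   (1+x)^n (1+x)^-(delta+n) = (1+x)^-delta.  The convergence of the series follows
   from the ratio test: Gamma(z)/Gamma(z+s) = B(s,z)/Gamma(s) tends to 0 as Re z
   grows, so no asymptotics of Gamma are needed.
   Uniqueness: the difference D of two solutions satisfies |D| <= K * |D| for a
   locally integrable K >= 0 supported on x > 0.  On ]0,T[, with weight exp(-m t)
   and m large, the kernel has L^1 norm less than 1, so D vanishes almost
   everywhere, and then everywhere by the equation itself. *)
Require Import Defs.
From HB Require Import structures.
From mathcomp Require Import all_boot all_order all_algebra.
From mathcomp Require Import complex ring lra.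
From mathcomp Require Import all_classical all_reals all_analysis.
From mathcomp Require Import measurable_realfun.

Set Implicit Arguments.
Unset Strict Implicit.
Unset Printing Implicit Defensive.

Import Order.TTheory GRing.Theory Num.Theory.
Import numFieldNormedType.Exports.

Local Open Scope classical_set_scope.
Local Open Scope ring_scope.
Local Open Scope complex_scope.

(** * Integration on the real line *)

Section AffineChange.
Variable R : realType.
Notation mu := (@lebesgue_measure R).
Implicit Types (f g : R -> \bar R) (b c : R).

(** Two obstacles shape the proof. Division by Gamma occurs in front of the fractional integrals, in
    the coefficients of the series and in the ratio test. The inverse is total (0 at 0 over C, the
    identity on bicomplex zero divisors), so at a zero of Gamma the fractions would neither cancel
    nor split into components. Hence it must be shown that Gamma has no zero for Re z > 0; the Beta
    relation yields this together with continuity at 1. Finiteness of the Beta integral comes from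
    the same convolution of Gamma kernels, read with values in [0, +oo]. The other obstacle: a
    solution is only assumed to have absolutely convergent fractional integrals. Its own
    measurability and local integrability have to be recovered from a kernel before any L^1 estimate
    applies. *)

Definition affine b c : R -> measurableTypeR R := fun x => c * x + b.

Lemma measurable_affine b c : measurable_fun [set: R] (affine b c).
Proof. by apply: measurable_funD => //; exact: measurable_funM. Qed.

Let push b c : {measure set (measurableTypeR R) -> \bar R} :=
  measure_function_pushforward__canonical__measure_function_Measure mu (measurable_affine b c).

Let scaled_push b c (cp : 0 < c) : {measure set (measurableTypeR R) -> \bar R} :=
  mscale (NngNum (ltW cp)) (push b c).

(** Both measures agree on the intervals []x, y]]: the preimage has length [(y - x) / c], and the
    scaling restores the factor [c]. Uniqueness of Lebesgue measure does the rest. *)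
Let scaled_pushE b c (cp : 0 < c) (A : set R) : measurable A ->
  scaled_push b cp A = mu A.
Proof.
move=> mA; apply/esym.
apply: (@lebesgue_measure_unique R (scaled_push b cp)) => // _ [[x y]] _ <-.
rewrite -[RHS]/(c%:E * mu (affine b c @^-1` `]x, y]))%E.
have -> : affine b c @^-1` `]x, y]%classic = `](x - b) / c, (y - b) / c]%classic.
  apply/seteqP; split => z /=; rewrite /affine !in_itv /= ltr_pdivrMr // ler_pdivlMr //;
  by rewrite ltrBlDr lerBrDr mulrC.
rewrite !lebesgue_measure_itv /= !lte_fin ltr_pM2r ?invr_gt0 // ltrD2r.
case: ifPn => _; last by rewrite mule0.
by rewrite -!EFinD -EFinM; congr EFin; field; rewrite gt_eqF.
Qed.

Lemma ge0_integral_affine f b c : 0 < c -> measurable_fun setT f ->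
  (forall x, 0 <= f x)%E ->
  (c%:E * \int[mu]_x f (c * x + b)%R = \int[mu]_x f x)%E.
Proof.
move=> cp mf f0; transitivity (\int[scaled_push b cp]_x f x)%E; last first.
  by apply: eq_measure_integral => A mA _; exact: scaled_pushE.
rewrite ge0_integral_mscale //= ge0_integral_pushforward ?preimage_setT //.
exact: measurable_affine.
Qed.

Lemma integrable_affine f b c : 0 < c -> mu.-integrable setT f ->
  mu.-integrable setT (fun x => f (c * x + b)).
Proof.
move=> cp /integrableP[mf fi]; apply/integrableP; split.
  by apply: (@measurableT_comp _ _ _ _ _ _ f) => //; exact: measurable_affine.
move: fi; rewrite -(@ge0_integral_affine (fun x => `|f x|)%E b c) //; last first.
  exact: measurableT_comp.
(* An infinite integral would stay infinite after multiplication by [c > 0]. *)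
set I := (integral _ _ _); case: I => [r||] //=; rewrite ?ltry //.
by rewrite gt0_muley ?lte_fin // ltxx.
Qed.

Lemma integral_affine f b c : 0 < c -> mu.-integrable setT f ->
  (c%:E * \int[mu]_x f (c * x + b)%R = \int[mu]_x f x)%E.
Proof.
move=> cp intf; have mf := measurable_int _ intf.
rewrite integralE [RHS]integralE.
rewrite -(@ge0_integral_affine (f^\+)%E b c) //; last exact: measurable_funepos.
rewrite -(@ge0_integral_affine (f^\-)%E b c) //; last exact: measurable_funeneg.
rewrite muleBr //; last exact: (integrable_add_def measurableT (integrable_affine b cp intf)).
rewrite -[X in (X^\+)%E]/(f \o affine b c) -[X in (X^\-)%E]/(f \o affine b c).
by rewrite funepos_comp funeneg_comp.
Qed.

End AffineChange.

(** * Convolution of nonnegative functions *)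

Section Convolution.
Variable R : realType.
Notation mu := (@lebesgue_measure R).
Implicit Types (f g : R -> \bar R).

Lemma measurable_conv_kernel f g : measurable_fun setT f -> measurable_fun setT g ->
  measurable_fun setT (fun p : R * R => f (p.1 - p.2)%R * g p.2)%E.
Proof.
move=> mf mg; apply: emeasurable_funM; last exact: measurableT_comp.
by apply: (measurableT_comp mf); exact: measurable_funB.
Qed.

Lemma ge0_integral_shift f b : measurable_fun setT f -> (forall x, 0 <= f x)%E ->
  (\int[mu]_x f (x - b)%R = \int[mu]_x f x)%E.
Proof.
move=> mf f0; rewrite -(@ge0_integral_affine R f (- b) 1) // mul1e.
by under [RHS]eq_integral do rewrite mul1r.
Qed.

(** Tonelli; by translation invariance the inner integral over [t] does not depend on [y]. *)
Lemma ge0_integral_conv f g : measurable_fun setT f -> measurable_fun setT g ->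
  (forall x, 0 <= f x)%E -> (forall x, 0 <= g x)%E ->
  (\int[mu]_t \int[mu]_y (f (t - y)%R * g y) =
   (\int[mu]_x f x) * \int[mu]_x g x)%E.
Proof.
move=> mf mg f0 g0.
rewrite (@fubini_tonelli _ _ _ _ _ mu mu (fun p : R * R => f (p.1 - p.2)%R * g p.2)%E) /=; last 2 first.
- exact: measurable_conv_kernel.
- by move=> p; exact: mule_ge0.
have mfB y : measurable_fun setT (fun t : R => f (t - y)).
  by apply: (measurableT_comp mf); exact: measurable_funB.
transitivity (\int[mu]_y ((\int[mu]_x f x) * g y))%E.
  apply: eq_integral => y _; rewrite ge0_integralZr //; last exact: mfB.
  by congr (_ * _)%E; exact: ge0_integral_shift.
by rewrite ge0_integralZl // integral_ge0.
Qed.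

End Convolution.

(** * Complex-valued integrals *)

Section ComplexIntegral.
Variable R : realType.
Notation mu := (@lebesgue_measure R).
Notation Re := (@complex.Re R).
Notation Im := (@complex.Im R).
Implicit Types (f g : R -> R[i]) (z w : R[i]).

(* Submultiplicative like the modulus, and directly comparable with the
   integrals of the real and imaginary parts. *)
Definition norm1 z : R := `|Re z| + `|Im z|.

Lemma complex_ext z w : Re z = Re w -> Im z = Im w -> z = w.
Proof. by case: z w => [a b] [c d] /= -> ->. Qed.

Lemma norm1_ge0 z : 0 <= norm1 z. Proof. exact: addr_ge0. Qed.

Lemma norm10 : norm1 0 = 0. Proof. by rewrite /norm1 /= normr0 addr0. Qed.

Lemma norm1_real (x : R) : norm1 x%:C = `|x|.
Proof. by rewrite /norm1 /= normr0 addr0. Qed.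

Lemma norm1D z w : norm1 (z + w) <= norm1 z + norm1 w.
Proof.
case: z w => [a b] [c d]; rewrite /norm1 /= addrACA.
by apply: lerD; exact: ler_normD.
Qed.

Lemma norm1M z w : norm1 (z * w) <= norm1 z * norm1 w.
Proof.
case: z w => [a b] [c d]; rewrite /norm1 /= mulrDl !mulrDr -!normrM.
apply: (@le_trans _ _ ((`|a * c| + `|b * d|) + (`|a * d| + `|b * c|))).
  by apply: lerD; [exact: ler_normB|exact: ler_normD].
by rewrite le_eqVlt; apply/orP; left; apply/eqP; ring.
Qed.

Lemma norm1_eq0 z : norm1 z <= 0 -> z = 0.
Proof.
case: z => a b; rewrite /norm1 /= => ab0.
have := normr_ge0 a; have := normr_ge0 b => b0 a0.
have /eqP : `|a| = 0 by lra.
have /eqP : `|b| = 0 by lra.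
by rewrite !normr_eq0 => /eqP -> /eqP ->.
Qed.

Definition cmeasurable f :=
  measurable_fun setT (Re \o f) /\ measurable_fun setT (Im \o f).

Lemma cmeasurable_norm1 f : cmeasurable f -> measurable_fun setT (norm1 \o f).
Proof. by move=> [mr mi]; apply: measurable_funD; exact: measurableT_comp. Qed.

Lemma cmeasurable_cst z : cmeasurable (fun=> z).
Proof. by split; exact: measurable_cst. Qed.

Lemma cmeasurableM f g : cmeasurable f -> cmeasurable g ->
  cmeasurable (fun x => f x * g x).
Proof.
move=> [fr fi] [gr gi]; split.
- rewrite (_ : _ \o _ = fun x => Re (f x) * Re (g x) - Im (f x) * Im (g x)).
    by apply: measurable_funB; exact: measurable_funM.
  by apply/funext => x /=; case: (f x) (g x) => [a b] [c d].
- rewrite (_ : _ \o _ = fun x => Re (f x) * Im (g x) + Im (f x) * Re (g x)).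
    by apply: measurable_funD; exact: measurable_funM.
  by apply/funext => x /=; case: (f x) (g x) => [a b] [c d].
Qed.

Lemma cmeasurable_affine f b c : cmeasurable f -> cmeasurable (fun x => f (c * x + b)).
Proof.
have maff := @measurable_affine R b c.
by move=> [fr fi]; split; [apply: (measurableT_comp fr)|apply: (measurableT_comp fi)].
Qed.

Lemma cintegrable_cmeasurable f : cintegrable setT f -> cmeasurable f.
Proof. by move=> [/measurable_int/measurable_EFinP fr /measurable_int/measurable_EFinP fi]. Qed.

Lemma cintegrable_norm1 f : cintegrable setT f ->
  mu.-integrable setT (EFin \o (norm1 \o f)).
Proof.
move=> [fr fi]; have := integrableD measurableT (integrable_abse fr) (integrable_abse fi).
by apply: eq_integrable.
Qed.

Lemma le_cintegrable f (g : R -> R) : cmeasurable f ->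
  mu.-integrable setT (EFin \o g) -> (forall x, norm1 (f x) <= g x) ->
  cintegrable setT f.
Proof.
move=> [fr fi] ig fg; split; apply: (le_integrable _ _ _ ig) => //.
- exact/measurable_EFinP.
- move=> x _ /=; rewrite lee_fin (le_trans _ (ler_norm _)) // (le_trans _ (fg x)) //.
  by rewrite /norm1 lerDl.
- exact/measurable_EFinP.
- move=> x _ /=; rewrite lee_fin (le_trans _ (ler_norm _)) // (le_trans _ (fg x)) //.
  by rewrite /norm1 lerDr.
Qed.

Lemma norm1_cintegral f : cintegrable setT f ->
  norm1 (cintegral setT f) <= \int[mu]_x norm1 (f x).
Proof.
move=> [fr fi]; rewrite /norm1 /cintegral /= RintegralD //; first last.
- exact: integrable_abse fi.
- exact: integrable_abse fr.
by apply: lerD; exact: le_normr_Rintegral.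
Qed.

Lemma eq_cintegral D f g : {in D, f =1 g} -> cintegral D f = cintegral D g.
Proof.
by move=> fg; congr (_ +i* _); apply: eq_Rintegral => x xD; rewrite fg.
Qed.

Lemma eq_cintegrable f g : f =1 g -> cintegrable setT f -> cintegrable setT g.
Proof. by move=> /funext ->. Qed.

Lemma cintegrable_mkcond (D : set (measurableTypeR R)) f : measurable D ->
  cintegrable D f <-> cintegrable setT (fun x => if x \in D then f x else 0).
Proof.
move=> mD; split=> -[fr fi]; split.
- by have /(integrable_mkcond _ mD) := fr; apply: eq_integrable => // x _; rewrite /restrict /=; case: ifP.
- by have /(integrable_mkcond _ mD) := fi; apply: eq_integrable => // x _; rewrite /restrict /=; case: ifP.
- by apply/(integrable_mkcond _ mD); move: fr; apply: eq_integrable => // x _; rewrite /restrict /=; case: ifP.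
- by apply/(integrable_mkcond _ mD); move: fi; apply: eq_integrable => // x _; rewrite /restrict /=; case: ifP.
Qed.

Lemma cintegral_mkcond (D : set (measurableTypeR R)) f :
  cintegral D f = cintegral setT (fun x => if x \in D then f x else 0).
Proof.
congr (_ +i* _); apply: (etrans (Rintegral_mkcond _ _ _));
  by apply: eq_Rintegral => x _; rewrite /restrict; case: ifP.
Qed.

Lemma cintegrableD f g : cintegrable setT f -> cintegrable setT g ->
  cintegrable setT (fun x => f x + g x).
Proof.
move=> [fr fi] [gr gi]; split.
- by have := integrableD measurableT fr gr; apply: eq_integrable => // x _ /=; case: (f x) (g x) => [? ?] [? ?].
- by have := integrableD measurableT fi gi; apply: eq_integrable => // x _ /=; case: (f x) (g x) => [? ?] [? ?].
Qed.

Lemma cintegralD f g : cintegrable setT f -> cintegrable setT g ->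
  cintegral setT (fun x => f x + g x) = cintegral setT f + cintegral setT g.
Proof.
move=> [fr fi] [gr gi]; rewrite /cintegral.
rewrite -[RHS]/((_ + _) +i* (_ + _)) -!RintegralD //.
by congr (_ +i* _); apply: eq_Rintegral => x _; case: (f x) (g x) => [? ?] [? ?].
Qed.

Lemma cintegrableZl z f : cintegrable setT f -> cintegrable setT (fun x => z * f x).
Proof.
move=> fi.
have := integrableZl measurableT (norm1 z) (cintegrable_norm1 fi).
move/(le_cintegrable (f := fun x => z * f x) (g := fun x => norm1 z * norm1 (f x))); apply.
- by apply: cmeasurableM; [exact: cmeasurable_cst|exact: cintegrable_cmeasurable].
- by move=> x; exact: norm1M.
Qed.

Lemma cintegralZl z f : cintegrable setT f ->
  cintegral setT (fun x => z * f x) = z * cintegral setT f.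
Proof.
case: z => a b [fr fi]; rewrite /cintegral.
have ZE (c : R) (h : R -> R) : mu.-integrable setT (EFin \o h) ->
    mu.-integrable setT (EFin \o (fun x => c * h x)).
  by move=> hi; have := integrableZl measurableT c hi; exact: eq_integrable.
rewrite -[RHS]/((_ - _) +i* (_ + _)) -!RintegralZl // -RintegralB -?RintegralD //; try exact: ZE.
by congr (_ +i* _); apply: eq_Rintegral => x _; case: (f x).
Qed.

Lemma cintegrable_affine f b c : 0 < c -> cintegrable setT f ->
  cintegrable setT (fun x => f (c * x + b)).
Proof.
move=> cp [fr fi].
by split; [exact: (integrable_affine b cp fr)|exact: (integrable_affine b cp fi)].
Qed.

Lemma Rintegral_affine (h : R -> R) b c : 0 < c -> mu.-integrable setT (EFin \o h) ->
  c * \int[mu]_x h (c * x + b) = \int[mu]_x h x.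
Proof.
move=> cp hi; rewrite /Rintegral -(integral_affine b cp hi) fineM //.
exact: (integrable_fin_num _ (integrable_affine b cp hi)).
Qed.

Lemma cintegral_affine f b c : 0 < c -> cintegrable setT f ->
  c%:C * cintegral setT (fun x => f (c * x + b)) = cintegral setT f.
Proof.
move=> cp [fr fi]; rewrite /cintegral -(Rintegral_affine b cp fr) -(Rintegral_affine b cp fi).
by apply/eqP; rewrite eq_complex /= !mul0r subr0 addr0 !eqxx.
Qed.

Definition ccvg (u : nat -> R[i]) z :=
  (fun n => Re (u n)) @ \oo --> Re z /\ (fun n => Im (u n)) @ \oo --> Im z.

Lemma ccvg_clim u z : ccvg u z -> clim u = z.
Proof.
by case: z => a b [ur ui]; rewrite /clim; congr (_ +i* _); exact: cvg_lim.
Qed.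

Lemma ccvg_cst z : ccvg (fun=> z) z.
Proof. by split; exact: cvg_cst. Qed.

Lemma ccvgD u v z w : ccvg u z -> ccvg v w -> ccvg (fun n => u n + v n) (z + w).
Proof.
move=> [ur ui] [vr vi]; split.
- rewrite (_ : (fun _ => _) = fun n => Re (u n) + Re (v n)); last first.
    by apply/funext => n; case: (u n) (v n) => [? ?] [? ?].
  by rewrite (_ : Re (z + w) = Re z + Re w); [exact: cvgD|case: z w {ur ui vr vi} => [? ?] [? ?]].
- rewrite (_ : (fun _ => _) = fun n => Im (u n) + Im (v n)); last first.
    by apply/funext => n; case: (u n) (v n) => [? ?] [? ?].
  by rewrite (_ : Im (z + w) = Im z + Im w); [exact: cvgD|case: z w {ur ui vr vi} => [? ?] [? ?]].
Qed.

Lemma ccvgM u v z w : ccvg u z -> ccvg v w -> ccvg (fun n => u n * v n) (z * w).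
Proof.
move=> [ur ui] [vr vi]; split.
- rewrite (_ : (fun _ => _) = fun n => Re (u n) * Re (v n) - Im (u n) * Im (v n)); last first.
    by apply/funext => n; case: (u n) (v n) => [? ?] [? ?].
  rewrite (_ : Re (z * w) = Re z * Re w - Im z * Im w); last by case: z w {ur ui vr vi} => [? ?] [? ?].
  by apply: cvgB; exact: cvgM.
- rewrite (_ : (fun _ => _) = fun n => Re (u n) * Im (v n) + Im (u n) * Re (v n)); last first.
    by apply/funext => n; case: (u n) (v n) => [? ?] [? ?].
  rewrite (_ : Im (z * w) = Re z * Im w + Im z * Re w); last by case: z w {ur ui vr vi} => [? ?] [? ?].
  by apply: cvgD; exact: cvgM.
Qed.

Lemma ccvg_unique u z w : ccvg u z -> ccvg u w -> z = w.
Proof. by move=> /ccvg_clim <- /ccvg_clim. Qed.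

Lemma eq_ccvg u v z : u =1 v -> ccvg u z -> ccvg v z.
Proof. by move=> /funext ->. Qed.

Lemma ccvg_shift k u z : ccvg u z -> ccvg (fun n => u (n + k)%N) z.
Proof.
by move=> [ur ui]; split; [exact: (cvg_comp _ _ (cvg_addnr k) ur)|exact: (cvg_comp _ _ (cvg_addnr k) ui)].
Qed.

Lemma Rintegral_dominated (h_ : nat -> R -> R) (h g : R -> R) :
  (forall n, measurable_fun setT (h_ n)) -> measurable_fun setT h ->
  (forall x, h_ ^~ x @ \oo --> h x) ->
  mu.-integrable setT (EFin \o g) -> (forall n x, `|h_ n x| <= g x) ->
  \int[mu]_x h_ n x @[n --> \oo] --> \int[mu]_x h x.
Proof.
move=> mh_ mh h_h ig hg.
suff : (\int[mu]_x (h_ n x)%:E)%E @[n --> \oo] --> (\int[mu]_x (h x)%:E)%E.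
  (* The limit inherits the bound [g], so its integral is finite and the extended-real convergence
     can be read in R. *)
  have hi : mu.-integrable setT (EFin \o h).
    apply: (le_integrable _ _ _ ig) => //; first exact/measurable_EFinP.
    move=> x _ /=; rewrite lee_fin (le_trans _ (ler_norm _)) //.
    have nh : `|h_ n x| @[n --> \oo] --> `|h x| by apply: cvg_norm.
    rewrite -(cvg_lim (@norm_hausdorff _ _) nh).
    by apply: limr_le; [apply/cvg_ex; exists (`|h x|)|exact: nearW].
  by rewrite -(fineK (integrable_fin_num measurableT hi)) => /fine_cvgP[].
have [] // := @dominated_convergence _ _ _ mu setT measurableT
  (fun n => EFin \o h_ n) (EFin \o h) (EFin \o g).
- by move=> n; apply/measurable_EFinP; exact: mh_.
- exact/measurable_EFinP.
- apply: aeW => x _; apply: cvg_EFin; last exact: h_h.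
  exact: nearW.
- by apply: aeW => x n _; rewrite lee_fin.
Qed.

Lemma ccvg_measurable (f_ : nat -> R -> R[i]) f : (forall n, cmeasurable (f_ n)) ->
  (forall x, ccvg (f_ ^~ x) (f x)) -> cmeasurable f.
Proof.
move=> mf ff; split.
- apply: (measurable_fun_cvg (h := fun n => Re \o f_ n)) => [n|x _]; first by have [] := mf n.
  by have [] := ff x.
- apply: (measurable_fun_cvg (h := fun n => Im \o f_ n)) => [n|x _]; first by have [] := mf n.
  by have [] := ff x.
Qed.

Lemma le_norm1_lim u z c : ccvg u z -> (forall n, norm1 (u n) <= c) -> norm1 z <= c.
Proof.
move=> [ur ui] uc; rewrite /norm1.
have un : (fun n => `|Re (u n)| + `|Im (u n)|) @ \oo --> `|Re z| + `|Im z|.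
  by apply: cvgD; exact: cvg_norm.
rewrite -(cvg_lim (@norm_hausdorff _ _) un); apply: limr_le; first by apply/cvg_ex; exists (`|Re z| + `|Im z|).
exact: nearW.
Qed.

Lemma cintegral_dominated (f_ : nat -> R -> R[i]) f (g : R -> R) :
  (forall n, cmeasurable (f_ n)) -> (forall x, ccvg (f_ ^~ x) (f x)) ->
  mu.-integrable setT (EFin \o g) -> (forall n x, norm1 (f_ n x) <= g x) ->
  cintegrable setT f /\ ccvg (fun n => cintegral setT (f_ n)) (cintegral setT f).
Proof.
move=> mf_ ff ig fg; have mf := ccvg_measurable mf_ ff.
split.
  by apply: (le_cintegrable mf ig) => x; apply: (le_norm1_lim (ff x)).
split; apply: (Rintegral_dominated (g := g)) => //.
- by move=> n; have [] := mf_ n.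
- by have [] := mf.
- by move=> x; have [] := ff x.
- by move=> n x; rewrite (le_trans _ (fg n x)) // /norm1 lerDl.
- by move=> n; have [] := mf_ n.
- by have [] := mf.
- by move=> x; have [] := ff x.
- by move=> n x; rewrite (le_trans _ (fg n x)) // /norm1 lerDr.
Qed.

(** Sections are assumed integrable at every point, not only almost everywhere, so that [fine] loses
    nothing on any inner integral. *)
Lemma Rintegral_fubini (h : R -> R -> R) :
  (mu \x mu)%E.-integrable setT (fun p => (h p.1 p.2)%:E) ->
  (forall t, mu.-integrable setT (fun y => (h t y)%:E)) ->
  (forall y, mu.-integrable setT (fun t => (h t y)%:E)) ->
  \int[mu]_t (\int[mu]_y h t y) = \int[mu]_y (\int[mu]_t h t y).
Proof.
move=> hi h1 h2; congr fine.
transitivity (\int[mu]_t \int[mu]_y (h t y)%:E)%E.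
  by apply: eq_integral => t _; rewrite fineK // (integrable_fin_num measurableT).
rewrite (Fubini hi).
by apply: eq_integral => t _; rewrite fineK // (integrable_fin_num measurableT).
Qed.

Definition cconv f g (t : R) := cintegral setT (fun y => f (t - y) * g y).

Lemma cintegrable_shift f b : cintegrable setT f -> cintegrable setT (fun x => f (x - b)).
Proof.
move=> /(cintegrable_affine (- b) ltr01); apply: eq_cintegrable => x.
by rewrite mul1r.
Qed.

Lemma cintegral_shift f b : cintegrable setT f ->
  cintegral setT (fun x => f (x - b)) = cintegral setT f.
Proof.
move=> fi; rewrite -(cintegral_affine (- b) ltr01 fi) mul1r.
by congr cintegral; apply/funext => x; rewrite mul1r.
Qed.

(** Tonelli for the norms gives integrability on the plane; Fubini is then applied to the real and
    the imaginary part. *)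
Lemma cintegral_conv f g : cintegrable setT f -> cintegrable setT g ->
  (forall t, cintegrable setT (fun y => f (t - y) * g y)) ->
  cintegral setT (cconv f g) = cintegral setT f * cintegral setT g.
Proof.
move=> fi gi fgi.
have [mfr mfi] := cintegrable_cmeasurable fi.
have [mgr mgi] := cintegrable_cmeasurable gi.
have sec y : cintegrable setT (fun t => f (t - y) * g y).
  have := cintegrableZl (g y) (cintegrable_shift y fi).
  by apply: eq_cintegrable => t; rewrite mulrC.
have mB : measurable_fun setT (fun p : R * R => p.1 - p.2) by exact: measurable_funB.
pose h (p : R * R) := f (p.1 - p.2) * g p.2.
have mhr : measurable_fun setT (fun p => Re (h p)).
  rewrite (_ : (fun _ => _) = fun p => Re (f (p.1 - p.2)) * Re (g p.2) - Im (f (p.1 - p.2)) * Im (g p.2)).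
    apply: measurable_funB; apply: measurable_funM.
    - exact: (measurableT_comp mfr mB).
    - exact: (measurableT_comp mgr measurable_snd).
    - exact: (measurableT_comp mfi mB).
    - exact: (measurableT_comp mgi measurable_snd).
  by apply/funext => p; rewrite /h; case: (f _) (g _) => [? ?] [? ?].
have mhi : measurable_fun setT (fun p => Im (h p)).
  rewrite (_ : (fun _ => _) = fun p => Re (f (p.1 - p.2)) * Im (g p.2) + Im (f (p.1 - p.2)) * Re (g p.2)).
    apply: measurable_funD; apply: measurable_funM.
    - exact: (measurableT_comp mfr mB).
    - exact: (measurableT_comp mgi measurable_snd).
    - exact: (measurableT_comp mfi mB).
    - exact: (measurableT_comp mgr measurable_snd).
  by apply/funext => p; rewrite /h; case: (f _) (g _) => [? ?] [? ?].
have F := cintegrable_norm1 fi; have G := cintegrable_norm1 gi.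
have bnd : (\int[mu]_t \int[mu]_y ((norm1 (f (t - y)))%:E * (norm1 (g y))%:E) < +oo)%E.
  rewrite (@ge0_integral_conv R (fun x => (norm1 (f x))%:E) (fun x => (norm1 (g x))%:E)).
  - apply: lte_mul_pinfty.
    + by apply: integral_ge0 => x _; rewrite lee_fin norm1_ge0.
    + exact: (integrable_fin_num measurableT F).
    + by have := integrable_fin_num measurableT G; rewrite fin_numE => /andP[_]; rewrite ltey.
  - exact: measurable_int F.
  - exact: measurable_int G.
  - by move=> x; rewrite lee_fin norm1_ge0.
  - by move=> x; rewrite lee_fin norm1_ge0.
(* Stated for any dominated [H], to serve for both the real and the imaginary part. *)
have ih (H : R * R -> R) : measurable_fun setT H ->
    (forall p, `|H p| <= norm1 (f (p.1 - p.2)) * norm1 (g p.2)) ->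
    (mu \x mu)%E.-integrable setT (EFin \o H).
  move=> mH leH; apply/integrable12ltyP; first exact/measurable_EFinP.
  apply: le_lt_trans bnd; apply: ge0_le_integral => //.
  - by move=> t _; exact: integral_ge0.
  - apply: (@measurable_fun_fubini_tonelli_F _ _ _ _ _ mu (fun p => `|(H p)%:E|%E)) => //.
    by apply: measurableT_comp => //; exact/measurable_EFinP.
  - apply: (@measurable_fun_fubini_tonelli_F _ _ _ _ _ mu
      (fun p : R * R => (norm1 (f (p.1 - p.2)))%:E * (norm1 (g p.2))%:E)%E) => //.
      exact: (@measurable_conv_kernel R (fun x => (norm1 (f x))%:E) (fun x => (norm1 (g x))%:E)
        (measurable_int _ F) (measurable_int _ G)).
    by move=> p; rewrite lee_fin mulr_ge0 // norm1_ge0.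
  - move=> t _; apply: ge0_le_integral => //.
    + apply: measurableT_comp => //; apply/measurable_EFinP.
      by apply: (measurableT_comp mH); exact: measurable_fun_pair.
    + apply: emeasurable_funM; last exact: measurable_int G.
      apply: (measurableT_comp (measurable_int _ F)).
      exact: measurable_funB.
    + by move=> y _; rewrite lee_fin (leH (t, y)).
have Re_le z : `|Re z| <= norm1 z by rewrite lerDl.
have Im_le z : `|Im z| <= norm1 z by rewrite lerDr.
transitivity (cintegral setT (fun y => cintegral setT (fun t => f (t - y) * g y))).
  apply: complex_ext.
  - apply: (Rintegral_fubini (h := fun t y => Re (h (t, y)))).
    + by apply: ih => // p; rewrite (le_trans (Re_le _)) // norm1M.
    + by move=> t; have [] := fgi t.
    + by move=> y; have [] := sec y.
  - apply: (Rintegral_fubini (h := fun t y => Im (h (t, y)))).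
    + by apply: ih => // p; rewrite (le_trans (Im_le _)) // norm1M.
    + by move=> t; have [] := fgi t.
    + by move=> y; have [] := sec y.
rewrite -cintegralZl //; apply: eq_cintegral => y _.
rewrite -(cintegral_shift y fi) mulrC -cintegralZl; last exact: cintegrable_shift.
by apply: eq_cintegral => t _; rewrite mulrC.
Qed.

End ComplexIntegral.

(** * Gamma and Beta integrals *)

Section Powers.
Variable R : realType.
Notation mu := (@lebesgue_measure R).
Notation Re := (@complex.Re R).
Notation Im := (@complex.Im R).
Implicit Types (z w : R[i]) (p q x c : R).

Lemma ReD z w : Re (z + w) = Re z + Re w. Proof. by case: z w => [? ?] [? ?]. Qed.
Lemma ImD z w : Im (z + w) = Im z + Im w. Proof. by case: z w => [? ?] [? ?]. Qed.

Lemma cpowD p z w : cpow p (z + w) = cpow p z * cpow p w.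
Proof.
rewrite /cpow ReD ImD !mulrDl expRD cosD sinD.
by apply: complex_ext => /=; ring.
Qed.

Lemma cpow0 p : cpow p 0 = 1.
Proof. by rewrite /cpow /= !mul0r expR0 cos0 sin0; apply: complex_ext => /=; ring. Qed.

Lemma cpow_neq0 p z : cpow p z != 0.
Proof.
apply/eqP => z0; have := cpowD p z (- z).
by rewrite subrr cpow0 z0 mul0r => /eqP; rewrite oner_eq0.
Qed.

Lemma cpowM p q z : 0 < p -> 0 < q -> cpow (p * q) z = cpow p z * cpow q z.
Proof.
move=> p0 q0; rewrite /cpow lnM ?posrE // !mulrDr expRD cosD sinD.
by apply: complex_ext => /=; ring.
Qed.

Lemma cpow_natl p k z : cpow p (k%:R * z) = cpow p z ^+ k.
Proof.
elim: k => [|k IH]; first by rewrite mul0r cpow0.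
by rewrite -addn1 natrD mulrDl mul1r cpowD IH exprD.
Qed.

Lemma cpow_real p x : 0 < p -> cpow p x%:C = (p `^ x)%:C.
Proof.
move=> p0; rewrite /cpow /= mul0r cos0 sin0 /powR gt_eqF //.
by apply: complex_ext => /=; ring.
Qed.

Lemma cpow1 p : 0 < p -> cpow p 1 = p%:C.
Proof. by move=> p0; rewrite (cpow_real 1) // powRr1 // ltW. Qed.

Lemma norm1_cpow p z : 0 < p -> norm1 (cpow p z) <= 2 * p `^ Re z.
Proof.
move=> p0; rewrite /cpow (le_trans (norm1M _ _)) // norm1_real ger0_norm ?expR_ge0 //.
rewrite /powR gt_eqF // mulrC ler_wpM2r ?expR_ge0 //.
by apply: lerD; [exact: cos_max|exact: sin_max].
Qed.

(* Extending powers by 0 to x <= 0 turns Riemann-Liouville and Beta integrals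
   into convolutions over the whole line. *)
Definition fpow z x : R[i] := if 0 < x then cpow x (z - 1) else 0.
Definition rfpow p x : R := if 0 < x then x `^ (p - 1) else 0.

Lemma rfpow_ge0 p x : 0 <= rfpow p x.
Proof. by rewrite /rfpow; case: ifP => // _; exact: powR_ge0. Qed.

Lemma measurable_pos : measurable_fun setT (fun x : R => 0 < x).
Proof. exact: measurable_fun_ltr. Qed.

Lemma measurable_rfpow p : measurable_fun setT (rfpow p).
Proof.
by apply: measurable_fun_ifT; [exact: measurable_pos|exact: measurable_powR|].
Qed.

Lemma cmeasurable_fpow z : cmeasurable (fpow z).
Proof.
have mcos : measurable_fun setT (@cos R) by apply: continuous_measurable_fun; exact: continuous_cos.
have msin : measurable_fun setT (@sin R) by apply: continuous_measurable_fun; exact: continuous_sin.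
have mln c : measurable_fun setT (fun x : R => c * ln x) by exact: measurable_funM.
split.
- rewrite (_ : _ \o _ = fun x => if 0 < x then
      expR (Re (z - 1) * ln x) * cos (Im (z - 1) * ln x) else 0); last first.
    by apply/funext => x; rewrite /= /fpow; case: ifP => // _; rewrite /cpow /=; ring.
  apply: measurable_fun_ifT => //; first exact: measurable_pos.
  by apply: measurable_funM; exact: measurableT_comp.
- rewrite (_ : _ \o _ = fun x => if 0 < x then
      expR (Re (z - 1) * ln x) * sin (Im (z - 1) * ln x) else 0); last first.
    by apply/funext => x; rewrite /= /fpow; case: ifP => // _; rewrite /cpow /=; ring.
  apply: measurable_fun_ifT => //; first exact: measurable_pos.
  by apply: measurable_funM; exact: measurableT_comp.
Qed.

Lemma norm1_fpow z x : norm1 (fpow z x) <= 2 * rfpow (Re z) x.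
Proof.
rewrite /fpow /rfpow; case: ifP => x0; last by rewrite norm10 mulr0.
by rewrite (le_trans (norm1_cpow _ x0)) // ReD.
Qed.

Lemma fpow_scale c z x : 0 < c -> fpow z (c * x) = cpow c (z - 1) * fpow z x.
Proof.
move=> c0; rewrite /fpow pmulr_rgt0 //; case: ifP => x0; last by rewrite mulr0.
by rewrite cpowM.
Qed.

Lemma rfpow_scale c p x : 0 < c -> rfpow p (c * x) = c `^ (p - 1) * rfpow p x.
Proof.
move=> c0; rewrite /rfpow pmulr_rgt0 //; case: ifP => x0; last by rewrite mulr0.
by rewrite powRM // ltW.
Qed.

(** The primitive [x^p / p] gives a bound independent of [c], as needed to exhaust ]0, 1] by the
    intervals [1/(n+1), 1]. *)
Lemma le_integral_powR p c : 0 < p -> 0 < c <= 1 ->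
  (\int[mu]_(x in `[c, 1%R]) (x `^ (p - 1))%:E <= (p^-1)%:E)%E.
Proof.
move=> p0 /andP[c0]; rewrite le_eqVlt => /orP[/eqP -> |c1].
  (* The case [c = 1] is a single point; the fundamental theorem below is used for [c < 1]. *)
  rewrite set_itv1 integral_set1 lee_fin invr_ge0 ltW //.
pose F x := p^-1 * x `^ p.
have dF x : 0 < x -> is_derive x 1 F (x `^ (p - 1)).
  move=> x0; have d := is_derive1_powR p x0.
  have -> : x `^ (p - 1) = p^-1 *: (p * x `^ (p - 1)) by rewrite scalerA mulVf ?gt_eqF // scale1r.
  exact: is_deriveZ.
have cF x : 0 < x -> F y @[y --> x] --> F x.
  move=> x0; apply: differentiable_continuous; apply/derivable1_diffP.
  by have [] := dF x x0.
rewrite (@continuous_FTC2 _ (fun x => x `^ (p - 1)) F) //.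
- rewrite /F powR1 mulr1 -EFinB lee_fin gerBl.
  by rewrite mulr_ge0 ?powR_ge0 // invr_ge0 ltW.
- apply: continuous_in_subspaceT => x; rewrite inE /= in_itv /= => /andP[cx _].
  have x0 := lt_le_trans c0 cx.
  apply: differentiable_continuous; apply/derivable1_diffP.
  by apply: derivable_powR; rewrite in_itv /= x0.
- split.
  + by move=> x; rewrite in_itv /= => /andP[cx _]; have [] := dF x (lt_trans c0 cx).
  + exact/cvg_at_right_filter/cF.
  + exact/cvg_at_left_filter/cF.
- move=> x; rewrite in_itv /= => /andP[cx _].
  by rewrite derive1E; have [_ ->] := dF x (lt_trans c0 cx).
Qed.

Lemma integrable_powR01 p : 0 < p ->
  mu.-integrable `]0, 1%R] (fun x => (x `^ (p - 1))%:E).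
Proof.
move=> p0.
have mpow : measurable_fun setT (fun x => (x `^ (p - 1))%:E).
  by apply/measurable_EFinP; exact: measurable_powR.
apply/integrableP; split; first exact: measurable_funTS.
under eq_integral do rewrite gee0_abs ?lee_fin ?powR_ge0 //.
rewrite itv_open_bnd_bigcup.
rewrite -(cvg_lim _ (ge0_nondecreasing_set_cvg_integral _ _ _ _)) //.
- apply: le_lt_trans (ltry p^-1); apply: lime_le.
    apply: ereal_nondecreasing_is_cvgn.
    apply: ge0_nondecreasing_set_nondecreasing_integral => //.
    + apply/nondecreasing_seqP => n; rewrite subsetEset; apply: subset_itvr.
      by rewrite bnd_simp !add0r lef_pV2 ?posrE // ler_nat.
    + by move=> i; exact: measurable_funTS.
    + by move=> i x _; rewrite lee_fin powR_ge0.
  apply: nearW => n; rewrite add0r; apply: le_integral_powR => //.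
  by rewrite invr_gt0 ltr0n /= invf_le1 // ler1n.
- apply/nondecreasing_seqP => n; rewrite subsetEset; apply: subset_itvr.
  by rewrite bnd_simp !add0r lef_pV2 ?posrE // ler_nat.
- by move=> i; exact: measurable_funTS.
- by move=> i x _; rewrite lee_fin powR_ge0.
Qed.

Lemma powR_expR_le p x : 0 < p -> 1 <= x ->
  x `^ (p - 1) * expR (- x) <= expR (p * ln (2 * p)) * expR (- (2^-1 * x)).
Proof.
move=> p0 x1; have x0 : 0 < x by exact: lt_le_trans x1.
have p2 : 0 < 2 * p by rewrite mulr_gt0.
apply: (@le_trans _ _ (x `^ p * expR (- x))).
  by rewrite ler_wpM2r ?expR_ge0 // ler_powR // gerBl.
rewrite /powR gt_eqF // -!expRD ler_expR.
(* This is [ln y < y] at [y = x / (2 p)]. After multiplication by [p] the power costs [x / 2], half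
   of the exponential decay. *)
have lnx : ln x <= x / (2 * p) + ln (2 * p).
  rewrite -lerBlDr -ln_div ?posrE //; apply/ltW/ln_sublinear.
  by rewrite divr_gt0.
have := ler_wpM2l (ltW p0) lnx.
rewrite mulrDr (_ : p * (x / (2 * p)) = x / 2); last by field; rewrite gt_eqF.
by lra.
Qed.

Lemma integrable_rfpow_expR p : 0 < p ->
  mu.-integrable setT (fun x => (rfpow p x * expR (- x))%:E).
Proof.
move=> p0; pose f := (fun x : R => x `^ (p - 1)) \_ `]0, 1].
pose c := 2 * expR (p * ln (2 * p)).
have fi : mu.-integrable setT (EFin \o f).
  have := (integrable_mkcond (mu := mu) (fun x => (x `^ (p - 1))%:E) (measurable_itv `]0, 1%R])).1 (integrable_powR01 p0).
  by rewrite /f -restrict_EFin.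
have h0 : 0 < 2^-1 :> R by rewrite invr_gt0.
have gi := integrableZl measurableT c (integrable_exponential_pdf h0).
have mexpN : measurable_fun setT (fun x : R => expR (- x)) by apply: measurableT_comp.
apply: (le_integrable _ _ _ (integrableD measurableT fi gi)) => //.
  by apply/measurable_EFinP; apply: measurable_funM => //; exact: measurable_rfpow.
move=> x _ /=; rewrite lee_fin ger0_norm ?mulr_ge0 ?rfpow_ge0 ?expR_ge0 //.
rewrite (le_trans _ (ler_norm _)) //.
have pdf0 : 0 <= c * exponential_pdf 2^-1 x.
  by rewrite mulr_ge0 ?exponential_pdf_ge0 ?ltW // mulr_gt0 ?expR_gt0.
have f0 : 0 <= f x by rewrite /f /restrict; case: ifP => // _; exact: powR_ge0.
rewrite /rfpow; case: ifPn => [x0|_]; last by rewrite mul0r addr_ge0.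
have [x1|x1] := leP x 1.
  rewrite -[leLHS]addr0 lerD // /f /restrict mem_set; last by rewrite /= in_itv /= x0.
  by rewrite ler_piMr ?powR_ge0 // expR_le1 oppr_le0 ltW.
rewrite -[leLHS]add0r lerD // (le_trans (powR_expR_le p0 (ltW x1))) //.
rewrite /exponential_pdf /restrict mem_set; last by rewrite /= in_itv /= (ltW x0).
by rewrite /c mulrACA mulfV // mul1r mulNr.
Qed.

(* An infinite Beta integral would, by scaling, make the convolution of two
   Gamma kernels infinite at every t > 0, whereas that convolution is integrable. *)
Lemma beta_integral_lty p q : 0 < p -> 0 < q ->
  (\int[mu]_u (rfpow p (1 - u) * rfpow q u)%:E < +oo)%E.
Proof.
move=> p0 q0; rewrite ltNge leye_eq; apply/negP => /eqP oo.
pose F p x := (rfpow p x * expR (- x))%:E : \bar R.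
have mF r : 0 < r -> measurable_fun setT (F r).
  by move=> r0; exact: measurable_int (integrable_rfpow_expR r0).
have F0 r x : (0 <= F r x)%E by rewrite lee_fin mulr_ge0 ?rfpow_ge0 ?expR_ge0.
have := ge0_integral_conv (mF p p0) (mF q q0) (F0 p) (F0 q).
have fin r : 0 < r -> (\int[mu]_x F r x \is a fin_num)%E.
  by move=> r0; exact: (integrable_fin_num measurableT (integrable_rfpow_expR r0)).
have mI : measurable_fun setT (fun t : R => \int[mu]_y (F p (t - y)%R * F q y))%E.
  apply: (@measurable_fun_fubini_tonelli_F _ _ _ _ _ mu (fun x : R * R => F p (x.1 - x.2)%R * F q x.2)%E) => //.
    exact: (measurable_conv_kernel (mF p p0) (mF q q0)).
  by move=> x; exact: mule_ge0.
suff -> : (\int[mu]_t \int[mu]_y (F p (t - y)%R * F q y) = +oo)%E.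
  by move=> E; move: (fin_numM (fin p p0) (fin q q0)); rewrite -E.
apply/eqP; rewrite -leye_eq.
apply: (@le_trans _ _ (\int[mu]_(t in `]0%R, 1%R]) \int[mu]_y (F p (t - y)%R * F q y))%E); last first.
  apply: ge0_subset_integral => // t _; apply: integral_ge0 => y _; exact: mule_ge0.
rewrite (@eq_integral _ _ _ mu _ (cst +oo%E)); last first.
  move=> t; rewrite inE /= in_itv /= => /andP[t0 _].
  (* The substitution [y = t u] pulls out the positive factor [t exp(-t) t^(p-1) t^(q-1)] and leaves
     the infinite Beta integral. *)
  rewrite -(@ge0_integral_affine _ (fun y => F p (t - y)%R * F q y)%E 0 t) //; last first.
  - by move=> y; exact: mule_ge0.
  - apply: emeasurable_funM; last exact: mF.
    by apply: (measurableT_comp (mF p p0)); exact: measurable_funB.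
  transitivity (t%:E * \int[mu]_u ((expR (- t) * t `^ (p - 1) * t `^ (q - 1))%:E * (rfpow p (1 - u) * rfpow q u)%:E))%E.
    congr (_ * _)%E; apply: eq_integral => u _.
    rewrite addr0 -[t - t * u](_ : t * (1 - u) = _) /F; last by ring.
    rewrite !rfpow_scale // -!EFinM; congr EFin.
    rewrite (_ : - t = - (t * (1 - u)) + - (t * u)); last by ring.
    by rewrite expRD; ring.
  rewrite ge0_integralZl //.
  - by rewrite oo gt0_muley ?gt0_muley // lte_fin // !mulr_gt0 ?expR_gt0 ?powR_gt0.
  - apply/measurable_EFinP; apply: measurable_funM; last exact: measurable_rfpow.
    by apply: (measurableT_comp (measurable_rfpow p)); exact: measurable_funB.
  - by move=> u _; rewrite lee_fin mulr_ge0 ?rfpow_ge0.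
  - by rewrite lee_fin !mulr_ge0 ?expR_ge0 ?powR_ge0.
rewrite integral_cst //= lebesgue_measure_itv /= lte_fin ltr01 gt0_mulye //.
by rewrite -EFinB subr0 lte_fin.
Qed.

Definition gamma_kernel z x : R[i] := fpow z x * (expR (- x))%:C.

Definition beta_kernel z w u : R[i] := fpow z (1 - u) * fpow w u.

Definition cbeta z w : R[i] := cintegral setT (beta_kernel z w).

Lemma cmeasurable_real (f : R -> R) : measurable_fun setT f -> cmeasurable (fun x => (f x)%:C).
Proof. by move=> mf; split => //; exact: measurable_cst. Qed.

Lemma cintegrable_gamma_kernel z : 0 < Re z -> cintegrable setT (gamma_kernel z).
Proof.
move=> z0; have := integrableZl measurableT 2 (integrable_rfpow_expR z0).
move/(le_cintegrable (f := gamma_kernel z) (g := fun x => 2 * (rfpow (Re z) x * expR (- x)))); apply.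
- apply: cmeasurableM; first exact: cmeasurable_fpow.
  by apply: cmeasurable_real; exact: measurableT_comp.
- move=> x; rewrite (le_trans (norm1M _ _)) // norm1_real ger0_norm ?expR_ge0 // mulrA.
  by rewrite ler_wpM2r ?expR_ge0 // norm1_fpow.
Qed.

Lemma cGammaE z : cGamma z = cintegral setT (gamma_kernel z).
Proof.
rewrite /cGamma cintegral_mkcond; apply: eq_cintegral => x _.
by rewrite /gamma_kernel /fpow mem_setE in_itv /= andbT; case: ifP; rewrite ?mul0r.
Qed.

Lemma cmeasurable_beta_kernel z w : cmeasurable (beta_kernel z w).
Proof.
apply: cmeasurableM; last exact: cmeasurable_fpow.
have := cmeasurable_affine 1 (-1) (cmeasurable_fpow z).
by congr cmeasurable; apply/funext => u; rewrite mulN1r addrC.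
Qed.

Lemma integrable_beta_kernel p q : 0 < p -> 0 < q ->
  mu.-integrable setT (fun u => (rfpow p (1 - u) * rfpow q u)%:E).
Proof.
move=> p0 q0; apply/integrableP; split.
  apply/measurable_EFinP; apply: measurable_funM; last exact: measurable_rfpow.
  by apply: (measurableT_comp (measurable_rfpow p)); exact: measurable_funB.
under eq_integral do rewrite gee0_abs ?lee_fin ?mulr_ge0 ?rfpow_ge0 //.
exact: beta_integral_lty.
Qed.

Lemma norm1_beta_kernel z w u :
  norm1 (beta_kernel z w u) <= 4 * (rfpow (Re z) (1 - u) * rfpow (Re w) u).
Proof.
rewrite (le_trans (norm1M _ _)) // (_ : 4 = 2 * 2); last by ring.
by rewrite mulrACA ler_pM ?norm1_ge0 ?norm1_fpow.
Qed.

Lemma cintegrable_beta_kernel z w : 0 < Re z -> 0 < Re w ->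
  cintegrable setT (beta_kernel z w).
Proof.
move=> z0 w0; have := integrableZl measurableT 4 (integrable_beta_kernel z0 w0).
move/(le_cintegrable (cmeasurable_beta_kernel z w)
  (g := fun u => 4 * (rfpow (Re z) (1 - u) * rfpow (Re w) u))); apply.
exact: norm1_beta_kernel.
Qed.

Lemma fpow_conv_scale z w t u : 0 < t ->
  fpow z (t - t * u) * fpow w (t * u) = cpow t (z + w - 2) * beta_kernel z w u.
Proof.
move=> t0; rewrite (_ : t - t * u = t * (1 - u)); last by ring.
rewrite !fpow_scale // mulrACA -cpowD; congr (cpow _ _ * _).
by ring.
Qed.

Lemma fpow_conv0 z w t u : t <= 0 -> fpow z (t - u) * fpow w u = 0.
Proof.
move=> t0; rewrite /fpow; case: ifPn => [tu|_]; last by rewrite mul0r.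
by rewrite ifF ?mulr0 //; apply/negbTE; rewrite -leNgt; lra.
Qed.

Lemma cintegrable_fpow_conv z w t : 0 < Re z -> 0 < Re w ->
  cintegrable setT (fun u => fpow z (t - u) * fpow w u).
Proof.
move=> z0 w0; have [t0|t0] := leP t 0.
  rewrite (_ : (fun _ => _) = fun=> 0); last by apply/funext => u; exact: fpow_conv0.
  by split; exact: integrable0.
have ti : 0 < t^-1 by rewrite invr_gt0.
have := cintegrableZl (cpow t (z + w - 2))
  (cintegrable_affine 0 ti (cintegrable_beta_kernel z0 w0)).
apply: eq_cintegrable => u; rewrite addr0 -fpow_conv_scale // mulrA mulfV ?mul1r //.
by rewrite gt_eqF.
Qed.

Lemma cconv_fpow z w t : 0 < Re z -> 0 < Re w ->
  cconv (fpow z) (fpow w) t = cbeta z w * fpow (z + w) t.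
Proof.
move=> z0 w0; rewrite /cconv [in RHS]/fpow; case: ifPn => t0; last first.
  rewrite mulr0 -(mul0r (cintegral setT (beta_kernel z w))).
  rewrite -cintegralZl; last exact: cintegrable_beta_kernel.
  by apply: eq_cintegral => u _; rewrite mul0r fpow_conv0 // leNgt.
rewrite -(cintegral_affine 0 t0 (cintegrable_fpow_conv t z0 w0)).
transitivity (t%:C * cintegral setT (fun u => cpow t (z + w - 2) * beta_kernel z w u)).
  by congr (_ * _); apply: eq_cintegral => u _; rewrite addr0 fpow_conv_scale.
rewrite cintegralZl; last exact: cintegrable_beta_kernel.
(* The Jacobian [t], written as [cpow t 1], raises the exponent from [z + w - 2] to [z + w - 1]. *)
rewrite -(cpow1 t0) mulrA -cpowD mulrC; congr (_ * cpow _ _).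
by ring.
Qed.

(** Since exp(-(t-u)) exp(-u) = exp(-t), the convolution of two Gamma kernels is [cbeta z w] times a
    third one. Its integral is the product of the two integrals. *)
Lemma cGamma_beta z w : 0 < Re z -> 0 < Re w ->
  cGamma z * cGamma w = cbeta z w * cGamma (z + w).
Proof.
move=> z0 w0.
have zw0 : 0 < Re (z + w) by rewrite ReD addr_gt0.
have kE t u : gamma_kernel z (t - u) * gamma_kernel w u =
    (expR (- t))%:C * (fpow z (t - u) * fpow w u).
  rewrite /gamma_kernel mulrACA -rmorphM -expRD mulrC.
  by congr ((expR _)%:C * _); ring.
have intk t : cintegrable setT (fun u => gamma_kernel z (t - u) * gamma_kernel w u).
  have := cintegrableZl (expR (- t))%:C (cintegrable_fpow_conv t z0 w0).
  by apply: eq_cintegrable => u; rewrite kE.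
rewrite !cGammaE -(cintegral_conv (cintegrable_gamma_kernel z0) (cintegrable_gamma_kernel w0) intk).
rewrite -cintegralZl; last exact: cintegrable_gamma_kernel.
apply: eq_cintegral => t _; rewrite /gamma_kernel mulrA -cconv_fpow // mulrC.
rewrite -cintegralZl; last exact: cintegrable_fpow_conv.
by apply: eq_cintegral => u _; rewrite -kE.
Qed.

End Powers.

(** * Gamma has no zero in the right half-plane *)

Section GammaNonzero.
Variable R : realType.
Notation mu := (@lebesgue_measure R).
Notation Re := (@complex.Re R).
Notation Im := (@complex.Im R).
Implicit Types (z w s : R[i]).

Lemma Rintegral_gt0 (h : R -> R) (a b m : R) : a < b -> 0 < m ->
  mu.-integrable setT (EFin \o h) -> (forall x, 0 <= h x) ->
  (forall x, a <= x < b -> m <= h x) -> 0 < \int[mu]_x h x.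
Proof.
move=> ab m0 hi h0 hm.
have hfin := integrable_fin_num measurableT hi.
rewrite -lte_fin /Rintegral fineK //.
apply: (@lt_le_trans _ _ (\int[mu]_(x in `[a, b[) (m%:E))%E).
  rewrite integral_cst //= lebesgue_measure_itv /= lte_fin ab -EFinD -EFinM lte_fin.
  by rewrite mulr_gt0 // subr_gt0.
apply: (@le_trans _ _ (\int[mu]_(x in `[a, b[) (h x)%:E)%E).
  apply: ge0_le_integral => //.
  - by move=> x _; rewrite lee_fin ltW.
  - by apply: measurable_funTS; exact: measurable_int hi.
apply: ge0_subset_integral => //.
- exact: measurable_int hi.
- by move=> x _; rewrite lee_fin.
Qed.

Lemma ccvg_cpow p (u : nat -> R[i]) z : ccvg u z -> ccvg (fun n => cpow p (u n)) (cpow p z).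
Proof.
move=> [ur ui]; rewrite /cpow; apply: ccvgM; split => /=; [|exact: cvg_cst| |].
- apply: (continuous_cvg _ (@continuous_expR R _)).
  by apply: cvgM => //; exact: cvg_cst.
- apply: (continuous_cvg _ (@continuous_cos R _)).
  by apply: cvgM => //; exact: cvg_cst.
- apply: (continuous_cvg _ (@continuous_sin R _)).
  by apply: cvgM => //; exact: cvg_cst.
Qed.

(** Positivity is enough: the integrand is nonnegative, and at least exp(-2) on [1, 2[. *)
Lemma cGamma1_neq0 : cGamma (1 : R[i]) != 0.
Proof.
have kE x : gamma_kernel (1 : R[i]) x = (if 0 < x then expR (- x) else 0)%:C.
  rewrite /gamma_kernel /fpow; case: ifP => _; last by rewrite mul0r.
  by rewrite subrr cpow0 mul1r.
have [gi _] := @cintegrable_gamma_kernel R 1 ltr01.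
apply/eqP => g0; have := congr1 Re g0; rewrite cGammaE /=.
apply/eqP; rewrite gt_eqF //.
apply: (@Rintegral_gt0 _ 1 2 (expR (- 2))); rewrite ?ltr1n ?expR_gt0 //.
- by move=> x; rewrite kE /=; case: ifP => // _; exact: expR_ge0.
- move=> x /andP[x1 x2]; rewrite kE /= (lt_le_trans ltr01 x1) ler_expR.
  by rewrite lerN2 ltW.
Qed.

(** The Beta relation with equal arguments: Gamma(z/2)^2 = B(z/2, z/2) Gamma(z). *)
Lemma cGamma_half z : 0 < Re z -> cGamma z = 0 -> cGamma (2^-1 * z) = 0.
Proof.
move=> z0 gz.
have h0 : 0 < Re (2^-1 * z).
  rewrite (_ : 2^-1 = (2^-1)%:C :> R[i]); last by rewrite fmorphV rmorph_nat.
  by case: z z0 {gz} => a b /= a0; rewrite mul0r subr0 mulr_gt0 // invr_gt0.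
have := cGamma_beta h0 h0.
rewrite -mulrDl (_ : 2^-1 + 2^-1 = 1 :> R[i]); last by field.
by rewrite mul1r gz mulr0 => /eqP; rewrite mulf_eq0 orbb => /eqP.
Qed.

Lemma cos_ge_cos1 (x : R) : `|x| <= 1 -> cos 1 <= cos x.
Proof.
have pi2 := @pi_ge2 R.
move=> x1; rewrite -(cos_norm x) leNgt ltr_cos -?leNgt // in_itv /= ?ler01 ?normr_ge0 /=; lra.
Qed.

(* By scaling, the integral of u^(z-1) over [1, 2] is a multiple of B(1, z); for
   |Im z| <= 1 its real part is positive. *)
Lemma cbeta1_neq0 z : 0 < Re z -> `|Im z| <= 1 -> cbeta 1 z != 0.
Proof.
move=> z0 z1; apply/eqP => b0.
have c1 : 0 < Re (1 : R[i]) by exact: ltr01.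
have conv0 t := cconv_fpow t c1 z0.
have I1 := cintegrable_fpow_conv 1 c1 z0.
have I2 := cintegrable_fpow_conv 2 c1 z0.
(* [fpow 1] is the indicator of the positive reals, so [h] is [u^(z-1)] cut to [1, 2[, while its
   integral is a difference of two multiples of B(1, z). *)
pose h (u : R) := fpow 1 (2 - u) * fpow z u + (-1) * (fpow 1 (1 - u) * fpow z u).
have hi : cintegrable setT h by apply: cintegrableD => //; exact: cintegrableZl.
have : cintegral setT h = 0.
  rewrite cintegralD //; last exact: cintegrableZl.
  rewrite cintegralZl // -[X in X + _]/(cconv _ _ 2) -[X in _ + _ * X]/(cconv _ _ 1).
  by rewrite !conv0 b0 !mul0r mulr0 addr0.
have hE u : h u = if 1 <= u < 2 then cpow u (z - 1) else 0.
  rewrite /h /fpow !subr_gt0 subrr !cpow0; case: (ltP u 1) => u1 /=.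
    by rewrite (lt_trans u1) ?ltr1n // !mul1r mulN1r subrr.
  rewrite (lt_le_trans ltr01 u1); case: (ltP u 2) => u2 /=.
    by rewrite mul1r mul0r mulr0 addr0.
  by rewrite !mul0r mulr0 addr0.
move/(congr1 Re); apply/eqP; rewrite gt_eqF // /cintegral /=.
have cos1 := @cos1_gt0 R.
(* Here [ln x] lies in [0, 1]: the exponent [(Re z - 1) ln x] is at least -1 and the angle
   [Im z ln x] is at most 1 in absolute value. *)
have bnd (x : R) : 1 <= x -> x < 2 -> expR (-1) * cos 1 <= Re (cpow x (z - 1)).
  move=> x1 x2; rewrite /cpow /= mul0r subr0.
  have ln0 : 0 <= ln x by exact: ln_ge0.
  have ln1 : ln x <= 1.
    have : - 1 < x - 1 by lra.
    by move/le_ln1Dx; rewrite addrC subrK; lra.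
  apply: ler_pM; rewrite ?expR_ge0 ?(ltW cos1) //.
    by rewrite ler_expR ReD /=; nra.
  apply: cos_ge_cos1; rewrite normrM (ger0_norm ln0) ImD /= subr0.
  by rewrite -[leRHS]mulr1 ler_pM.
apply: (@Rintegral_gt0 _ 1 2 (expR (- 1) * cos 1)); rewrite ?ltr1n ?mulr_gt0 ?expR_gt0 //.
- by have [] := hi.
- move=> x; rewrite hE; case: ifP => // /andP[x1 x2]; apply: le_trans (bnd x x1 x2).
  by rewrite mulr_ge0 ?expR_ge0 ?ltW.
- by move=> x /andP[x1 x2]; rewrite hE x1 x2; exact: bnd.
Qed.

(* A zero at z yields zeros at all z / 2^n, hence at 1 + z / 2^n for n large,
   against the continuity of Gamma at 1. *)
Lemma cGamma_neq0 z : 0 < Re z -> cGamma z != 0.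
Proof.
move=> z0; apply/eqP => gz.
have half0 w : Re (2^-1 * w) = 2^-1 * Re w /\ Im (2^-1 * w) = 2^-1 * Im w.
  rewrite (_ : 2^-1 = (2^-1)%:C :> R[i]); last by rewrite fmorphV rmorph_nat.
  by case: w => a b /=; rewrite !mul0r subr0 addr0.
pose u (n : nat) := iter n (fun w => 2^-1 * w) z.
have uRe n : Re (u n) = geometric (Re z) 2^-1 n.
  elim: n => [|n IH] /=; first by rewrite expr0 mulr1.
  by rewrite (half0 _).1 IH /= exprS mulrCA.
have uIm n : Im (u n) = geometric (Im z) 2^-1 n.
  elim: n => [|n IH] /=; first by rewrite expr0 mulr1.
  by rewrite (half0 _).2 IH /= exprS mulrCA.
have u_gt0 n : 0 < Re (u n) by rewrite uRe /= mulr_gt0 // exprn_gt0.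
have gu n : cGamma (u n) = 0.
  by elim: n => [//|n IH]; exact: (cGamma_half (u_gt0 n) IH).
have h1 : `|2^-1 : R| < 1 by rewrite ger0_norm // invf_lt1 // ltr1n.
have u_cvg : ccvg u 0.
  split; [rewrite (funext uRe)|rewrite (funext uIm)]; exact: cvg_geometric.
(* In Gamma(1) Gamma(u) = B(1, u) Gamma(1 + u) the left side is 0, and the Beta factor is not once
   |Im u| <= 1. *)
have gu1 : \forall n \near \oo, cGamma (1 + u n) = 0.
  have [_ /cvgrPdist_le /(_ 1 ltr01)] := u_cvg.
  apply: filterS => n; rewrite sub0r normrN => un1.
  have := @cGamma_beta R 1 (u n) ltr01 (u_gt0 n).
  rewrite gu mulr0 => /esym/eqP; rewrite mulf_eq0 (negPf (cbeta1_neq0 (u_gt0 n) un1)) /=.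
  by move/eqP.
have cg : ccvg (fun n => cGamma (1 + u n)) (cGamma 1).
  have -> : (fun n => cGamma (1 + u n)) = (fun n => cintegral setT (gamma_kernel (1 + u n))).
    by apply/funext => n; rewrite cGammaE.
  rewrite cGammaE.
  (* Since [0 <= Re (u n) <= Re z], the power [x^(Re (u n))] is at most 1 for [x <= 1] and at most
     [x^(Re z)] beyond; the majorant adds both. *)
  have I1 := @integrable_rfpow_expR R 1 ltr01.
  have I2 := @integrable_rfpow_expR R (1 + Re z) (addr_gt0 ltr01 z0).
  have I := integrableZl measurableT 2 (integrableD measurableT I1 I2).
  have [//||||] := @cintegral_dominated R (fun n => gamma_kernel (1 + u n)) (gamma_kernel 1)
    (fun x => 2 * (rfpow 1 x * expR (- x) + rfpow (1 + Re z) x * expR (- x))).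
  - by move=> n; apply/cintegrable_cmeasurable/cintegrable_gamma_kernel; rewrite ReD addr_gt0.
  - move=> x; apply: ccvgM; last exact: ccvg_cst.
    rewrite /fpow; case: ifP => x0; last exact: ccvg_cst.
    apply: ccvg_cpow; rewrite -[1 - 1 in X in ccvg _ X]addr0.
    apply: (eq_ccvg (u := fun n => (1 - 1) + u n)); last by apply: ccvgD => //; exact: ccvg_cst.
    by move=> n; rewrite addrAC.
  - exact: I.
  - move=> n x; rewrite (le_trans (norm1M _ _)) // norm1_real ger0_norm ?expR_ge0 //.
    rewrite -mulrDl mulrA ler_wpM2r ?expR_ge0 // (le_trans (norm1_fpow _ _)) // ler_wpM2l //.
    rewrite /rfpow; case: ifP => x0; last by rewrite addr0.
    rewrite ReD /= (_ : 1 - 1 = 0) ?subrr // powRr0 addrAC subrr add0r addrAC subrr add0r.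
    have un : 0 <= Re (u n) <= Re z.
      rewrite (ltW (u_gt0 n)) /= uRe; apply: ler_piMr; first exact: ltW.
      by apply: exprn_ile1 => //; rewrite ltW // (le_lt_trans (ler_norm _) h1).
    case/andP: un => un0 unz; have [x1|x1] := leP x 1.
      rewrite -[leLHS]addr0 lerD ?powR_ge0 //.
      have := @ger_powR R x _ _ _ un0; rewrite x0 x1 powRr0; exact.
    by rewrite -[leLHS]add0r lerD // ler_powR // ltW.
  by move=> _.
have := ccvg_unique cg; move/(_ 0) => E.
have := cGamma1_neq0; rewrite E ?eqxx //.
by split; apply: cvg_near_cst; apply: filterS gu1 => n ->.
Qed.

End GammaNonzero.

(** * Ratio test and decay of Beta integrals *)

Section Series.
Variable R : realType.
Notation mu := (@lebesgue_measure R).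
Notation Re := (@complex.Re R).
Notation Im := (@complex.Im R).
Implicit Types (z w s : R[i]).

Lemma ratio_test_bounded (u r : nat -> R) : (forall k, 0 <= u k) ->
  (forall k, u k.+1 <= r k * u k) -> r @ \oo --> 0 ->
  exists M, forall m, \sum_(k < m) u k <= M.
Proof.
move=> u0 ur r0.
have h0 : 0 < 2^-1 :> R by rewrite invr_gt0.
have [N _ rN] : \forall k \near \oo, r k <= 2^-1.
  by have /cvgrPdist_le /(_ _ h0) := r0; apply: filterS => k; rewrite sub0r normrN; exact: le_trans (ler_norm _).
exists (\sum_(k < N) u k + 2 * u N) => m.
(* With ratios at most 1/2, the partial sum plus twice the next term no longer increases. *)
have key j : \sum_(k < N + j) u k + 2 * u (N + j)%N <= \sum_(k < N) u k + 2 * u N.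
  elim: j => [|j IH]; first by rewrite addn0.
  apply: le_trans IH; rewrite addnS big_ord_recr /= -addrA lerD2l.
  have := ur (N + j)%N; have := u0 (N + j)%N; have := rN (N + j)%N (leq_addr _ _).
  by move=> a b c; nra.
apply: le_trans (key m); rewrite -[leLHS]addr0 lerD ?mulr_ge0 //.
by rewrite addnC big_split_ord /= lerDl sumr_ge0.
Qed.

Lemma abs_summable_ccvg (v : nat -> R[i]) M :
  (forall m, \sum_(k < m) norm1 (v k) <= M) ->
  exists z, ccvg (fun m => \sum_(k < m) v k) z.
Proof.
move=> vM.
have cv (h : R[i] -> R) : (forall z, `|h z| <= norm1 z) -> {morph h : z w / z + w} -> h 0 = 0 ->
    cvgn (fun m => h (\sum_(k < m) v k)).
  move=> hb hD h0.
  have -> : (fun m => h (\sum_(k < m) v k)) = series (h \o v).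
    by apply/funext => m; rewrite (big_morph h hD h0) /series /= big_mkord.
  apply: normed_cvg; apply: nondecreasing_is_cvgn.
    by apply: nondecreasing_series => n _ _; exact: normr_ge0.
  exists M => _ [m _ <-]; rewrite /normed_series_of /series /= big_mkord; apply: le_trans (vM m).
  by apply: ler_sum => i _; exact: hb.
exists (limn (fun m => Re (\sum_(k < m) v k)) +i* limn (fun m => Im (\sum_(k < m) v k))).
split => /=; [apply: cv => // [z|]|apply: cv => // [z|]].
- by rewrite lerDl.
- exact: ReD.
- by rewrite lerDr.
- exact: ImD.
Qed.

Lemma natrC (k : nat) : k%:R = (k%:R : R)%:C.
Proof. by rewrite rmorph_nat. Qed.

Lemma norm1_natr (k : nat) : norm1 (k%:R : R[i]) = k%:R.
Proof. by rewrite natrC norm1_real ger0_norm. Qed.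

Lemma Re_mulr_natr z (k : nat) : Re (z * k%:R) = Re z * k%:R.
Proof. by rewrite natrC; case: z => a b /=; rewrite mulr0 subr0. Qed.

Lemma norm1_cbeta z w : 0 < Re z -> 0 < Re w ->
  norm1 (cbeta z w) <= 4 * \int[mu]_u (rfpow (Re z) (1 - u) * rfpow (Re w) u).
Proof.
move=> z0 w0; have hi := cintegrable_beta_kernel z0 w0.
have bi := integrable_beta_kernel z0 w0.
rewrite (le_trans (norm1_cintegral hi)) // -RintegralZl //.
apply: le_Rintegral => //; first exact: cintegrable_norm1.
  by have := integrableZl measurableT 4 bi; apply: eq_integrable.
by move=> u _; exact: norm1_beta_kernel.
Qed.

Lemma rfpowD p q (x : R) : rfpow (p + q) x = x `^ p * rfpow q x.
Proof.
rewrite /rfpow; case: ifP => x0; last by rewrite mulr0.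
by rewrite -addrA; apply: powRD; rewrite (gt_eqF x0) implybT.
Qed.

Lemma powR_muln (x p : R) (k : nat) : x `^ (p * k%:R) = (x `^ p) ^+ k.
Proof. by rewrite powRrM powR_mulrn // powR_ge0. Qed.

(** Adding [s k] to the second argument multiplies the majorant of the integrand by [u^(k Re s)],
    which tends to 0 on ]0, 1[. The majorant for [k = 0] dominates, and it vanishes off ]0, 1[. *)
Lemma cbeta_cvg0 s tau : 0 < Re s -> 0 < Re tau ->
  (fun k => norm1 (cbeta s (s * k%:R + tau))) @ \oo --> 0.
Proof.
move=> s0 t0.
have stk k : Re (s * k%:R + tau) = Re s * k%:R + Re tau by rewrite ReD Re_mulr_natr.
pose h (k : nat) u := rfpow (Re s) (1 - u) * rfpow (Re s * k%:R + Re tau) u.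
have hE k u : h k u = (u `^ Re s) ^+ k * (rfpow (Re s) (1 - u) * rfpow (Re tau) u).
  by rewrite /h rfpowD powR_muln mulrCA.
have mh k : measurable_fun setT (h k).
  apply: measurable_funM; last exact: measurable_rfpow.
  by apply: (measurableT_comp (measurable_rfpow _)); exact: measurable_funB.
have h0 k u : 0 <= h k u by rewrite mulr_ge0 ?rfpow_ge0.
have bi := integrable_beta_kernel s0 t0.
have out u : ~~ (0 < u < 1) -> rfpow (Re s) (1 - u) * rfpow (Re tau) u = 0.
  rewrite negb_and -!leNgt /rfpow => /orP[u0|u1].
    by rewrite [X in _ * X]ifF ?mulr0 //; apply/negbTE; rewrite -leNgt.
  by rewrite ifF ?mul0r //; apply/negbTE; rewrite -leNgt subr_le0.
have lt1 u : 0 < u < 1 -> 0 <= u `^ Re s < 1.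
  move=> /andP[u0 u1]; rewrite powR_ge0 /=.
  have : u `^ Re s < 1 `^ Re s by apply: gt0_ltr_powR; rewrite // nnegrE ltW.
  by rewrite powR1.
have cvgI : (fun k => \int[mu]_u h k u) @ \oo --> \int[mu]_u (cst 0 u : R).
  apply: (Rintegral_dominated (g := fun u => rfpow (Re s) (1 - u) * rfpow (Re tau) u)) => //.
  - move=> u; rewrite (funext (fun k => hE k u)).
    have [u01|u01] := boolP (0 < u < 1); last first.
      by rewrite out //; under eq_fun do rewrite mulr0; exact: cvg_cst.
    rewrite -(mul0r (rfpow (Re s) (1 - u) * rfpow (Re tau) u)); apply: cvgMl.
    by apply: cvg_expr; have /andP[a b] := lt1 _ u01; rewrite ger0_norm.
  - move=> k u; rewrite ger0_norm // hE.
    have [u01|u01] := boolP (0 < u < 1); last by rewrite out // mulr0.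
    have /andP[a b] := lt1 _ u01.
    by rewrite ler_piMl ?mulr_ge0 ?rfpow_ge0 // exprn_ile1 // ltW.
have I0 : \int[mu]_u (cst 0 u : R) = 0 by rewrite /Rintegral integral0.
have : (fun k => 4 * \int[mu]_u h k u) @ \oo --> 4 * (0 : R).
  by rewrite -I0; apply: cvgMr.
rewrite mulr0; apply: squeeze_cvgr; last exact: cvg_cst.
apply: nearW => k /=; rewrite norm1_ge0 /= (le_trans (norm1_cbeta _ _)) ?stk //.
by rewrite ltr_wpDl ?mulr_ge0 // ltW.
Qed.

End Series.

(** * The solution series *)

Section PrabhakarSeries.
Variable R : realType.
Notation mu := (@lebesgue_measure R).
Notation Re := (@complex.Re R).
Notation Im := (@complex.Im R).
Implicit Types (z w s tau delta b nu : R[i]).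

(** The coefficient of x^k in (1 - x)^-delta. *)
Definition binom_coef delta (k : nat) : R[i] :=
  (\prod_(i < k) (delta + i%:R)) / k`!%:R.

Lemma binom_coefS delta k :
  binom_coef delta k.+1 = binom_coef delta k * ((delta + k%:R) / k.+1%:R).
Proof.
rewrite /binom_coef big_ord_recr /= factS natrM invfM.
by ring.
Qed.

Definition pcoef s tau delta (k : nat) : R[i] :=
  binom_coef delta k / cGamma (s * k%:R + tau).

Lemma Re_gt0_affine s tau (k : nat) : 0 < Re s -> 0 < Re tau -> 0 < Re (s * k%:R + tau).
Proof. by move=> s0 t0; rewrite ReD Re_mulr_natr ltr_wpDl ?mulr_ge0 // ltW. Qed.

(** As Gamma has no zero, the Beta relation shows B(z, w) nonzero as well and can be solved for
    1/Gamma(z + w). This form feeds both the ratio test and the termwise fractional integral. *)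
Lemma inv_cGammaD z w : 0 < Re z -> 0 < Re w ->
  (cGamma (z + w))^-1 = cbeta z w / (cGamma z * cGamma w).
Proof.
move=> z0 w0; rewrite cGamma_beta // invfM mulrA.
have zw : cGamma (z + w) != 0 by rewrite cGamma_neq0 // ReD addr_gt0.
have : cbeta z w != 0.
  have := cGamma_beta z0 w0; apply: contra_eq_neq => ->.
  by rewrite mul0r mulf_neq0 // cGamma_neq0.
by move=> b0; rewrite mulfV // mul1r.
Qed.

Lemma pcoef_summable s tau delta (X : R) : 0 < Re s -> 0 < Re tau -> 0 <= X ->
  exists M, forall m, \sum_(k < m) norm1 (pcoef s tau delta k) * X ^+ k <= M.
Proof.
move=> s0 t0 X0.
(* The first factor bounds [(delta + k) / (k + 1)]; the rest bounds [X] times the quotient of two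
   consecutive 1/Gamma values. *)
pose r k := (norm1 delta + 1) * norm1 (cGamma s)^-1 * X * norm1 (cbeta s (s * k%:R + tau)).
apply: (@ratio_test_bounded R (fun k => norm1 (pcoef s tau delta k) * X ^+ k) r).
- by move=> k; rewrite mulr_ge0 ?norm1_ge0 // exprn_ge0.
- move=> k.
  have E : pcoef s tau delta k.+1 = pcoef s tau delta k *
      (((delta + k%:R) / k.+1%:R) * (cbeta s (s * k%:R + tau) * (cGamma s)^-1)).
    rewrite /pcoef binom_coefS -addn1 natrD mulrDr mulr1 -addrA [s + tau]addrC addrA addrC.
    rewrite inv_cGammaD ?Re_gt0_affine // invfM.
    by ring.
  have d1 : norm1 ((delta + k%:R) / k.+1%:R) <= norm1 delta + 1.
    rewrite (le_trans (norm1M _ _)) //.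
    have -> : norm1 (k.+1%:R^-1 : R[i]) = k.+1%:R^-1.
      by rewrite natrC -fmorphV norm1_real ger0_norm.
    rewrite ler_pdivrMr // (le_trans (norm1D _ _)) // norm1_natr.
    rewrite mulrDl mul1r lerD ?ler_nat // ler_peMr ?norm1_ge0 // ler1n //.
  rewrite E exprS /r.
  set c := cbeta _ _; set g := (cGamma s)^-1; set e := pcoef _ _ _ _; set d := _ / _ in d1 *.
  apply: (@le_trans _ _ (norm1 e * ((norm1 delta + 1) * (norm1 c * norm1 g)) * (X * X ^+ k))); last first.
    by rewrite le_eqVlt; apply/orP; left; apply/eqP; ring.
  rewrite ler_wpM2r ?mulr_ge0 ?exprn_ge0 // (le_trans (norm1M _ _)) // ler_wpM2l ?norm1_ge0 //.
  rewrite (le_trans (norm1M _ _)) // ler_pM ?norm1_ge0 //.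
  exact: norm1M.
- rewrite -[X in _ --> X](mulr0 ((norm1 delta + 1) * norm1 (cGamma s)^-1 * X)).
  by apply: cvgMr; exact: cbeta_cvg0.
Qed.

Lemma norm1X z k : norm1 (z ^+ k) <= norm1 z ^+ k.
Proof.
elim: k => [|k IH]; first by rewrite !expr0 (norm1_natr _ 1).
by rewrite !exprS (le_trans (norm1M _ _)) // ler_wpM2l ?norm1_ge0.
Qed.

(** The prefactor [t^(tau-1)] is absorbed, so that each term is a multiple of one [fpow] and the
    convolution rule acts on it directly; [b] will be [- cpow p s]. *)
Definition pterm s tau delta b (k : nat) (u : R) : R[i] :=
  pcoef s tau delta k * b ^+ k * fpow (s * k%:R + tau) u.

Definition pseries s tau delta b (u : R) : R[i] :=
  clim (fun m => \sum_(k < m) pterm s tau delta b k u).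

(** Replacing [u^(k Re s)] by [t^(k Re s)] separates [k] from [u], which gives all partial sums a
    common integrable majorant. *)
Lemma norm1_pterm s tau delta b k (t u : R) : 0 < Re s -> 0 < t -> u <= t ->
  norm1 (pterm s tau delta b k u) <=
  norm1 (pcoef s tau delta k) * (norm1 b * t `^ Re s) ^+ k * (2 * rfpow (Re tau) u).
Proof.
move=> s0 t0 ut; rewrite /pterm exprMn.
rewrite (le_trans (norm1M _ _)) //.
have [u0|u0] := leP u 0.
  rewrite /fpow /rfpow ltNge u0 /= norm10 !mulr0 //.
apply: (@le_trans _ _ (norm1 (pcoef s tau delta k) * norm1 b ^+ k *
   (2 * (t `^ Re s) ^+ k * rfpow (Re tau) u))); last first.
  by rewrite le_eqVlt; apply/orP; left; apply/eqP; ring.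
apply: ler_pM; rewrite ?norm1_ge0 //.
  by rewrite (le_trans (norm1M _ _)) // ler_wpM2l ?norm1_ge0 ?norm1X.
rewrite (le_trans (norm1_fpow _ _)) // -mulrA ler_wpM2l //.
rewrite ReD Re_mulr_natr rfpowD powR_muln ler_wpM2r ?rfpow_ge0 //.
rewrite lerXn2r ?nnegrE ?powR_ge0 // ge0_ler_powR ?nnegrE ?(ltW s0) ?(ltW u0) ?(ltW t0) //.
Qed.

Lemma pterm_summable s tau delta b (t : R) : 0 < Re s -> 0 < Re tau -> 0 < t ->
  exists M, 0 <= M /\ forall u m, u <= t ->
    \sum_(k < m) norm1 (pterm s tau delta b k u) <= M * rfpow (Re tau) u.
Proof.
move=> s0 tau0 t0.
have X0 : 0 <= norm1 b * t `^ Re s by rewrite mulr_ge0 ?norm1_ge0 ?powR_ge0.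
have [M HM] := pcoef_summable delta s0 tau0 X0.
exists (M * 2); split.
  by rewrite mulr_ge0 //; have := HM 0%N; rewrite big_ord0.
move=> u m ut; rewrite -mulrA.
apply: le_trans (ler_wpM2r _ (HM m)); last by rewrite mulr_ge0 ?rfpow_ge0.
by rewrite mulr_suml; apply: ler_sum => k _; exact: norm1_pterm.
Qed.

Lemma ccvg_pseries s tau delta b (u : R) : 0 < Re s -> 0 < Re tau ->
  ccvg (fun m => \sum_(k < m) pterm s tau delta b k u) (pseries s tau delta b u).
Proof.
move=> s0 tau0.
(* A positive bound above [u], whatever the sign of [u]. *)
have t0 : 0 < Num.max u 1 by rewrite lt_max ltr01 orbT.
have ut : u <= Num.max u 1 by rewrite le_max lexx.
have [M [_ HM]] := pterm_summable delta b s0 tau0 t0.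
have [z cz] := abs_summable_ccvg (v := fun k => pterm s tau delta b k u) (fun m => HM u m ut).
by rewrite /pseries (ccvg_clim cz).
Qed.

Lemma pseries_le0 s tau delta b (u : R) : u <= 0 -> pseries s tau delta b u = 0.
Proof.
move=> u0; apply: ccvg_clim; apply: (eq_ccvg _ (ccvg_cst 0)) => m.
by rewrite big1 // => k _; rewrite /pterm /fpow ltNge u0 /= mulr0.
Qed.

Lemma integrable_rfpow_conv (p q t : R) : 0 < p -> 0 < q ->
  mu.-integrable setT (fun u => (rfpow p (t - u) * rfpow q u)%:E).
Proof.
move=> p0 q0.
have [h _] := @cintegrable_fpow_conv R p%:C q%:C t p0 q0.
move: h; apply: eq_integrable => // u _; congr EFin.
have fE (r x : R) : fpow r%:C x = (rfpow r x)%:C.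
  rewrite /fpow /rfpow; case: ifP => // x0.
  by rewrite -(rmorph1 (real_complex R)) -rmorphB cpow_real.
by rewrite !fE /= mulr0 subr0.
Qed.

Lemma cintegral_sum (f : nat -> R -> R[i]) m : (forall k, cintegrable setT (f k)) ->
  cintegrable setT (fun u => \sum_(k < m) f k u) /\
  cintegral setT (fun u => \sum_(k < m) f k u) = \sum_(k < m) cintegral setT (f k).
Proof.
move=> fi; elim: m => [|m [IH1 IH2]].
  have -> : (fun u => \sum_(k < 0) f k u) = fun u => 0 * f 0%N u.
    by apply/funext => u; rewrite big_ord0 mul0r.
  by rewrite big_ord0; split; [exact: cintegrableZl|rewrite cintegralZl // mul0r].
have E : (fun u => \sum_(k < m.+1) f k u) = fun u => \sum_(k < m) f k u + f m u.
  by apply/funext => u; rewrite big_ord_recr.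
by rewrite E big_ord_recr; split; [exact: cintegrableD|rewrite cintegralD // IH2].
Qed.

(** Dominated convergence carries the convolution through the series. On each term the Beta factor
    combines with the Gamma factors into [1 / Gamma(nu + s k + tau)]. *)
Lemma cconv_pseries s tau delta b nu (t : R) :
  0 < Re s -> 0 < Re tau -> 0 < Re nu -> 0 < t ->
  cintegrable setT (fun u => fpow nu (t - u) * pseries s tau delta b u) /\
  ccvg (fun m => \sum_(k < m) binom_coef delta k * b ^+ k *
          (fpow (nu + (s * k%:R + tau)) t / cGamma (nu + (s * k%:R + tau))))
       ((cGamma nu)^-1 * cconv (fpow nu) (pseries s tau delta b) t).
Proof.
move=> s0 tau0 nu0 t0.
have [M [M0 HM]] := pterm_summable delta b s0 tau0 t0.
pose f m u := fpow nu (t - u) * \sum_(k < m) pterm s tau delta b k u.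
pose g k u := pcoef s tau delta k * b ^+ k * (fpow nu (t - u) * fpow (s * k%:R + tau) u).
have gi k : cintegrable setT (g k).
  by apply: cintegrableZl; apply: cintegrable_fpow_conv => //; exact: Re_gt0_affine.
have fE m : f m = fun u => \sum_(k < m) g k u.
  apply/funext => u; rewrite /f mulr_sumr; apply: eq_bigr => k _.
  by rewrite /g /pterm; ring.
have I := integrableZl measurableT (2 * M) (integrable_rfpow_conv t nu0 tau0).
have [||||I1 I2] := @cintegral_dominated R f (fun u => fpow nu (t - u) * pseries s tau delta b u)
    (fun u => 2 * M * (rfpow (Re nu) (t - u) * rfpow (Re tau) u)).
- by move=> m; rewrite fE; have [/cintegrable_cmeasurable] := cintegral_sum m gi.
- by move=> u; apply: ccvgM; [exact: ccvg_cst|exact: ccvg_pseries].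
- exact: I.
- move=> m u; rewrite /f (le_trans (norm1M _ _)) //.
  have [ut|ut] := ltP u t; last first.
    by rewrite /fpow /rfpow subr_gt0 ltNge ut /= norm10 !mul0r mulr0.
  rewrite mulrACA ler_pM ?norm1_ge0 ?norm1_fpow //.
  apply: le_trans (HM u m (ltW ut)).
  elim/big_rec2: _ => [|k x y _ xy]; first by rewrite norm10.
  by rewrite (le_trans (norm1D _ _)) // lerD2l.
split=> //.
have := ccvgM (ccvg_cst (cGamma nu)^-1) I2; apply: eq_ccvg => m.
rewrite fE (cintegral_sum m gi).2 mulr_sumr; apply: eq_bigr => k _.
have k0 := Re_gt0_affine k s0 tau0.
rewrite /g cintegralZl; last exact: cintegrable_fpow_conv.
rewrite -[cintegral _ _]/(cconv (fpow nu) _ t) cconv_fpow // inv_cGammaD // /pcoef invfM.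
by ring.
Qed.

End PrabhakarSeries.

(** * Existence of the solution in one component *)

Section Existence.
Variable R : realType.
Notation mu := (@lebesgue_measure R).
Notation Re := (@complex.Re R).
Notation Im := (@complex.Im R).
Implicit Types (z w s tau delta b nu : R[i]).

Definition cprabhakar s tau delta (zeta : R[i]) : R[i] :=
  clim (fun n => \sum_(0 <= k < n)
    (\prod_(i < k) (delta + i%:R)) / (k`!%:R * cGamma (s * k%:R + tau)) * zeta ^+ k).

Definition ckinetic_term s tau delta (p : R) (N0 : R[i]) (t : R) : R[i] :=
  N0 * cpow t (tau - 1) * cprabhakar s tau delta (- cpow (p * t) s).

Lemma cpow_natr p z k : cpow p (z * k%:R) = cpow p z ^+ k.
Proof. by rewrite mulrC cpow_natl. Qed.

Lemma ckinetic_termE s tau delta (p : R) N0 (t : R) :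
  0 < Re s -> 0 < Re tau -> 0 < p -> 0 < t ->
  ckinetic_term s tau delta p N0 t = N0 * pseries s tau delta (- cpow p s) t.
Proof.
move=> s0 tau0 p0 t0.
have cF := ccvg_pseries delta (- cpow p s) t s0 tau0.
(* [clim] is computed from a proved limit: that of [pseries], divided by the nonzero [t^(tau-1)]. *)
suff /ccvg_clim : ccvg (fun n => \sum_(0 <= k < n)
    (\prod_(i < k) (delta + i%:R)) / (k`!%:R * cGamma (s * k%:R + tau)) * (- cpow (p * t) s) ^+ k)
    ((cpow t (tau - 1))^-1 * pseries s tau delta (- cpow p s) t).
  rewrite /ckinetic_term /cprabhakar => ->.
  by rewrite -mulrA mulVKf // cpow_neq0.
have := ccvgM (ccvg_cst (cpow t (tau - 1))^-1) cF; apply: eq_ccvg => n.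
rewrite big_mkord mulr_sumr; apply: eq_bigr => k _.
rewrite /pterm /pcoef /binom_coef /fpow t0 cpowM //.
rewrite (_ : cpow t (s * k%:R + tau - 1) = cpow t s ^+ k * cpow t (tau - 1)); last first.
  by rewrite -addrA (cpowD t (s * k%:R)) -(cpow_natr t s k).
rewrite -(mulNr (cpow p s)) (exprMn k (- cpow p s)).
have c0 := cpow_neq0 t (tau - 1).
rewrite (invfM k`!%:R); set c := cpow t (tau - 1) in c0 *.
rewrite [LHS](_ : _ = c^-1 * c * ((\prod_(i < k) (delta + i%:R)) * k`!%:R^-1 *
  (cGamma (s * k%:R + tau))^-1 * (- cpow p s) ^+ k * cpow t s ^+ k)); last by ring.
by rewrite mulVf // mul1r; ring.
Qed.

(** Multiplication of (1 - x)^-(delta+1) by 1 - x, read at x^(k+1). *)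
Lemma binom_coef_diff delta k :
  binom_coef (delta + 1) k.+1 - binom_coef (delta + 1) k = binom_coef delta k.+1.
Proof.
have P : \prod_(i < k.+1) (delta + i%:R) = delta * \prod_(i < k) (delta + 1 + i%:R) :> R[i].
  rewrite big_ord_recl addr0; congr (_ * _); apply: eq_bigr => i _.
  by rewrite lift0 -addrA -natr1 [1 + _]addrC.
have k0 : k.+1%:R != 0 :> R[i] by rewrite pnatr_eq0.
have f0 : k`!%:R != 0 :> R[i] by rewrite pnatr_eq0 -lt0n fact_gt0.
rewrite binom_coefS /binom_coef P factS natrM -natr1 in k0 *.
by field; rewrite k0 f0.
Qed.

Lemma binomial_sumS n (F : nat -> R[i]) :
  \sum_(r < n.+2) 'C(n.+1, r)%:R * F r =
  \sum_(r < n.+1) 'C(n, r)%:R * F r + \sum_(r < n.+1) 'C(n, r)%:R * F r.+1.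
Proof.
rewrite big_ord_recl bin0.
under eq_bigr do rewrite lift0 binS natrD mulrDl.
rewrite big_split /= addrA; congr (_ + _).
transitivity (\sum_(r < n.+2) 'C(n, r)%:R * F r); first by rewrite [RHS]big_ord_recl bin0.
by rewrite big_ord_recr /= bin_small // mul0r addr0.
Qed.

(* The coefficient of x^j in (1+x)^n (1+x)^-(delta+n) = (1+x)^-delta. *)
Lemma binom_coef_sum delta n j :
  \sum_(r < n.+1 | (r <= j)%N) 'C(n, r)%:R * ((- 1) ^+ (j - r) * binom_coef (delta + n%:R) (j - r)) =
  (- 1) ^+ j * binom_coef delta j.
Proof.
pose q d j : R[i] := (- 1) ^+ j * binom_coef d j.
(* The coefficient of x^j in x^r (1+x)^-d; [shiftS] then takes out a factor 1 + x. *)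
pose shift r d j : R[i] := if (r <= j)%N then q d (j - r)%N else 0.
have shiftS r d i : shift r (d + 1) i + shift r.+1 (d + 1) i = shift r d i.
  rewrite /shift; case: (ltngtP r i) => [ri|//|->].
  - rewrite -(subnSK ri) /q exprS -(binom_coef_diff d).
    by ring.
  - by rewrite addr0.
  - by rewrite subnn /q /binom_coef !big_ord0 addr0.
rewrite big_mkcond /= -[RHS]/(q delta j).
transitivity (\sum_(r < n.+1) 'C(n, r)%:R * shift r (delta + n%:R) j).
  by apply: eq_bigr => r _; rewrite /shift; case: ifP; rewrite ?mulr0.
have -> : q delta j = shift 0%N delta j by rewrite /shift subn0.
elim: n delta => [|n IH] delta.
  by rewrite big_ord_recl big_ord0 bin0 mul1r !addr0.
rewrite -IH -natr1 addrA (binomial_sumS _ (fun r => shift r (delta + n%:R + 1) j)) -big_split /=.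
by apply: eq_bigr => r _; rewrite -mulrDr shiftS.
Qed.

Definition ckinetic_solution s tau delta (p : R) (N0 : R[i]) (n : nat) (N : R -> R[i]) : Prop :=
  forall t : R, 0 < t ->
    (forall r, (1 <= r <= n)%N ->
       cintegrable `]0, t[ (fun u => cpow (t - u) (r%:R * s - 1) * N u)) /\
    N t - ckinetic_term s tau delta p N0 t =
      - \sum_(1 <= r < n.+1) 'C(n, r)%:R * cpow p (r%:R * s) *
          ((cGamma (r%:R * s))^-1 *
             cintegral `]0, t[ (fun u => cpow (t - u) (r%:R * s - 1) * N u)).

(** The equation constrains [N] on [u > 0] only, so the convolution is taken with its extension by
    0; the kernel itself cuts at [u < t]. *)
Lemma RL_kernelE nu (N M : R -> R[i]) (t : R) :
  (forall u, M u = if 0 < u then N u else 0) ->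
  (fun u => if u \in `]0, t[%classic then cpow (t - u) (nu - 1) * N u else 0) =
  (fun u => fpow nu (t - u) * M u).
Proof.
move=> ME; apply/funext => u; rewrite ME /fpow subr_gt0 mem_setE in_itv /=.
by case: (0 < u); case: (u < t); rewrite ?mulr0 ?mul0r.
Qed.

Lemma ckinetic_solution_exists s tau delta (p : R) (N0 : R[i]) n :
  0 < Re s -> 0 < Re tau -> 0 < p ->
  ckinetic_solution s tau delta p N0 n (ckinetic_term s tau (delta + n%:R) p N0).
Proof.
move=> s0 tau0 p0 t t0.
set b := cpow p s; set N := ckinetic_term _ _ _ _ _.
pose F := pseries s tau (delta + n%:R) (- b).
have NE u : N0 * F u = if 0 < u then N u else 0.
  by case: ifPn => u0; [rewrite /N ckinetic_termE|rewrite /F pseries_le0 ?mulr0 // leNgt].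
have rs0 r : (0 < r)%N -> 0 < Re (r%:R * s).
  by move=> r0; rewrite mulrC Re_mulr_natr mulr_gt0 // ltr0n.
have FI r (r0 : (0 < r)%N) := cconv_pseries (delta + n%:R) (- b) s0 tau0 (rs0 r r0) t0.
split.
  move=> r /andP[r1 _]; apply/cintegrable_mkcond; first exact: measurable_itv.
  rewrite (RL_kernelE _ _ NE).
  have := cintegrableZl N0 (FI r r1).1; apply: eq_cintegrable => u.
  by rewrite mulrCA.
have IE r : (0 < r)%N -> cintegral `]0, t[ (fun u => cpow (t - u) (r%:R * s - 1) * N u) =
    N0 * cconv (fpow (r%:R * s)) F t.
  move=> r0; rewrite cintegral_mkcond (RL_kernelE _ _ NE) -cintegralZl; last by have [] := FI r r0.
  by apply: eq_cintegral => u _; rewrite mulrCA.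
pose c (j : nat) := b ^+ j * (fpow (s * j%:R + tau) t / cGamma (s * j%:R + tau)).
pose q (d : R[i]) k := (- 1) ^+ k * binom_coef d k.
(* A partial sum of [b^r J^(r s) F], indexed by the total power [j = k + r] of [b], so that
   different [r] can be added coefficientwise. *)
pose S r m := \sum_(j < m | (r <= j)%N) q (delta + n%:R) (j - r)%N * c j.
have SE r m : S r (m + r)%N =
    \sum_(k < m) b ^+ r * (binom_coef (delta + n%:R) k * (- b) ^+ k *
      (fpow (r%:R * s + (s * k%:R + tau)) t / cGamma (r%:R * s + (s * k%:R + tau)))).
  rewrite /S addnC big_split_ord /= big1 ?add0r; last first.
    by move=> i; rewrite leqNgt ltn_ord.
  rewrite (eq_bigl predT) => [|i]; last by rewrite leq_addr.
  apply: eq_bigr => k _; rewrite addKn /q /c exprD -(mulN1r b) (exprMn k (-1) b).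
  have -> : s * (r + k)%:R + tau = r%:R * s + (s * k%:R + tau).
    by rewrite natrD mulrDr addrA [s * r%:R]mulrC.
  by ring.
(* Order 0 stands for the identity and is set apart, because the integral formula needs a positive
   order. *)
pose L r := b ^+ r * (if r is 0%N then F t else (cGamma (r%:R * s))^-1 * cconv (fpow (r%:R * s)) F t).
have Scvg r : ccvg (fun m => S r (m + r)%N) (L r).
  apply: (eq_ccvg (fun m => esym (SE r m))).
  apply: (eq_ccvg (u := fun m => b ^+ r * \sum_(k < m) binom_coef (delta + n%:R) k * (- b) ^+ k *
      (fpow (r%:R * s + (s * k%:R + tau)) t / cGamma (r%:R * s + (s * k%:R + tau))))).
    by move=> m; rewrite mulr_sumr.
  apply: ccvgM; first exact: ccvg_cst.
  case: r => [|r]; last by have [] := FI r.+1 (ltn0Sn r).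
  have := ccvg_pseries (delta + n%:R) (- b) t s0 tau0; apply: eq_ccvg => m.
  apply: eq_bigr => k _; rewrite mul0r add0r /pterm /pcoef.
  by ring.
(* One truncation [m + n] for all [r]: it is the index [m + r] of [Scvg], shifted by [n - r]. *)
have key : ccvg (fun m => \sum_(r < n.+1) 'C(n, r)%:R * S r (m + n)%N)
    (\sum_(r < n.+1) 'C(n, r)%:R * L r).
  have gen (I : seq 'I_n.+1) : ccvg (fun m => \sum_(r <- I) 'C(n, r)%:R * S r (m + n)%N)
    (\sum_(r <- I) 'C(n, r)%:R * L r).
    elim: I => [|r I IH].
      by rewrite big_nil; apply: (eq_ccvg _ (ccvg_cst 0)) => m; rewrite big_nil.
    rewrite big_cons; apply: (eq_ccvg (u := fun m => 'C(n, r)%:R * S r (m + n)%N +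
      \sum_(r <- I) 'C(n, r)%:R * S r (m + n)%N)) => [m|]; first by rewrite big_cons.
    apply: ccvgD => //; apply: ccvgM; first exact: ccvg_cst.
    have := ccvg_shift (n - r) (Scvg r); apply: eq_ccvg => m.
    by rewrite -addnA subnK // -ltnS ltn_ord.
  exact: gen.
(* At a common truncation the collapse is an identity of finite sums, by [binom_coef_sum] for each
   [j]. *)
have key2 : ccvg (fun m => \sum_(r < n.+1) 'C(n, r)%:R * S r (m + n)%N) (pseries s tau delta (- b) t).
  have := ccvg_shift n (ccvg_pseries delta (- b) t s0 tau0); apply: eq_ccvg => m.
  transitivity (\sum_(j < m + n) q delta j * c j).
    apply: eq_bigr => j _; rewrite /pterm /pcoef /q /c -(mulN1r b) (exprMn j (-1) b).
    by ring.
  transitivity (\sum_(r < n.+1) \sum_(j < m + n)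
      if (r <= j)%N then 'C(n, r)%:R * (q (delta + n%:R) (j - r)%N) * c j else 0); last first.
    apply: eq_bigr => r _; rewrite /S mulr_sumr [RHS]big_mkcond /=.
    by apply: eq_bigr => j _; case: ifP => // _; rewrite mulrA.
  rewrite exchange_big; apply: eq_bigr => j _ /=.
  rewrite /q -(binom_coef_sum delta n j) mulr_suml big_mkcond /=.
  by apply: eq_bigr => r _; case: ifP.
have E := ccvg_unique key2 key.
rewrite ckinetic_termE // E big_ord_recl bin0 mul1r /L expr0 mul1r.
have := NE t; rewrite t0 => <-.
rewrite mulrDr opprD addrA subrr add0r; congr (- _).
rewrite big_add1 big_mkord mulr_sumr; apply: eq_bigr => r _.
rewrite IE // lift0 cpow_natl -/b.
by ring.
Qed.

End Existence.

(** * Uniqueness *)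

Section Uniqueness.
Variable R : realType.
Notation mu := (@lebesgue_measure R).
Notation Re := (@complex.Re R).
Notation Im := (@complex.Im R).
Implicit Types (z w s tau delta b nu : R[i]).

(** Integration gives [g <= k g] with [k < 1]; finiteness of [g] excludes [g = +oo]. *)
Lemma conv_subinvariant_eq0 (K G : R -> \bar R) :
  measurable_fun setT K -> measurable_fun setT G ->
  (forall x, 0 <= K x)%E -> (forall x, 0 <= G x)%E ->
  (\int[mu]_x K x < 1)%E -> (\int[mu]_x G x < +oo)%E ->
  (forall t, G t <= \int[mu]_u (K (t - u)%R * G u))%E ->
  forall t, G t = 0%E.
Proof.
move=> mK mG K0 G0 K1 Gfin GK.
have I0 : (\int[mu]_x G x = 0)%E.
  have Ige : (0 <= \int[mu]_x G x)%E by exact: integral_ge0.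
  have mI : measurable_fun setT (fun t : R => \int[mu]_u (K (t - u)%R * G u))%E.
    apply: (@measurable_fun_fubini_tonelli_F _ _ _ _ _ mu (fun x : R * R => K (x.1 - x.2)%R * G x.2)%E) => //.
      exact: (measurable_conv_kernel mK mG).
    by move=> x; exact: mule_ge0.
  have : (\int[mu]_x G x <= (\int[mu]_x K x) * \int[mu]_x G x)%E.
    rewrite -ge0_integral_conv //; exact: ge0_le_integral.
  have : (0 <= \int[mu]_x K x)%E by exact: integral_ge0.
  move: Ige Gfin K1; move: (integral mu setT G) (integral mu setT K) => [g| |] [k| |] //.
  rewrite lte_fin !lee_fin => g0 _ k1 k0 gk.
  by congr EFin; nra.
have G_ae : ae_eq mu setT G (cst 0%E).
  apply/(ae_eq_integral_abs mu measurableT mG).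
  by rewrite -[RHS]I0; apply: eq_integral => x _; rewrite gee0_abs.
move=> t; apply/eqP; rewrite eq_le G0 andbT (le_trans (GK t)) //.
have mKt : measurable_fun setT (fun u : R => K (t - u)).
  by apply: (measurableT_comp mK); exact: measurable_funB.
rewrite (ae_eq_integral (cst 0%E)) ?integral0 //.
  exact: emeasurable_funM.
by apply: filterS G_ae => u /(_ I) /= ->; rewrite mule0.
Qed.

(** For [x < T] the factor [exp(T - x)] is at least 1, so [exp T] times the Gamma kernel
    dominates. *)
Lemma integrable_rfpow_trunc (p T : R) : 0 < p ->
  mu.-integrable setT (fun x => (if x < T then rfpow p x else 0)%:E).
Proof.
move=> p0; have I := integrableZl measurableT (expR T) (integrable_rfpow_expR p0).
apply: (le_integrable _ _ _ I) => //.
  apply/measurable_EFinP; apply: measurable_fun_ifT => //; last exact: measurable_rfpow.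
  exact: measurable_fun_ltr.
move=> x _ /=; rewrite lee_fin; case: ifP => xT; last by rewrite normr0.
rewrite !ger0_norm ?mulr_ge0 ?rfpow_ge0 ?expR_ge0 // mulrCA -expRD.
by rewrite ler_peMr ?rfpow_ge0 // -expR0 ler_expR subr_ge0 ltW.
Qed.

(* Multiplying a kernel by exp (- m x) makes its integral small: on a bounded
   interval this turns any Volterra operator into a contraction of L^1. *)
Lemma laplace_small (K : R -> R) : measurable_fun setT K -> (forall x, 0 <= K x) ->
  (forall x, x <= 0 -> K x = 0) -> mu.-integrable setT (EFin \o K) ->
  exists m : nat, (\int[mu]_x (expR (- (m%:R * x)) * K x)%:E < 1)%E.
Proof.
move=> mK K0 Kneg iK.
have mE m : measurable_fun setT (fun x : R => expR (- (m%:R * x)) * K x).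
  apply: measurable_funM => //; apply: measurableT_comp => //.
  by apply: measurableT_comp => //; exact: measurable_funM.
have bE m x : `|expR (- (m%:R * x)) * K x| <= K x.
  rewrite ger0_norm ?mulr_ge0 ?expR_ge0 //.
  have [x0|x0] := leP x 0; first by rewrite Kneg // mulr0.
  by rewrite ler_piMl // expR_le1 oppr_le0 mulr_ge0 // ltW.
have iE m : mu.-integrable setT (EFin \o (fun x => expR (- (m%:R * x)) * K x)).
  apply: (le_integrable _ _ _ iK) => //; first by apply/measurable_EFinP; exact: mE.
  by move=> x _ /=; rewrite lee_fin (le_trans (bE m x)) // ler_norm.
have : (fun m : nat => \int[mu]_x (expR (- (m%:R * x)) * K x)) @ \oo --> \int[mu]_x (cst 0 x : R).
  apply: (Rintegral_dominated (g := K)) => //.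
  move=> x; have [x0|x0] := leP x 0.
    by rewrite Kneg //; under eq_fun do rewrite mulr0; exact: cvg_cst.
  rewrite -[X in _ --> X](mul0r (K x)); apply: cvgMl.
  have e1 : `|expR (- x)| < 1 by rewrite ger0_norm ?expR_ge0 // expR_lt1 oppr_lt0.
  rewrite (_ : (fun m => _) = (fun m : nat => expR (- x) ^+ m)); first exact: cvg_expr.
  by apply/funext => m; rewrite -mulrN expRM_natl.
rewrite [X in _ --> X](_ : _ = 0); last by rewrite /Rintegral integral0.
move=> /cvgrPdist_lt /(_ 1 ltr01) [m _ /(_ m (leqnn m))]; rewrite sub0r normrN => Lm.
exists m; have fin := integrable_fin_num measurableT (iE m).
rewrite -(fineK fin) lte_fin; exact: le_lt_trans (ler_norm _) Lm.
Qed.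

(* The kernel at 2T is bounded away from 0 on ]0, T[, which transfers the
   integrability required from a solution to the solution itself. *)
Lemma truncated_cintegrable s (M : R -> R[i]) (T : R) : 0 < T ->
  (forall u, u <= 0 -> M u = 0) ->
  cintegrable setT (fun u => fpow s (2 * T - u) * M u) ->
  cintegrable setT (fun u => if u < T then M u else 0).
Proof.
move=> T0 Mneg iM.
(* [fpow (2 - s)] is the reciprocal of [fpow s]: the exponents are [1 - s] and [s - 1]. *)
pose i u := if u < T then fpow (2 - s) (2 * T - u) else 0.
have E u : i u * (fpow s (2 * T - u) * M u) = if u < T then M u else 0.
  rewrite /i; case: ifP => uT; last by rewrite mul0r.
  have v0 : 0 < 2 * T - u by lra.
  rewrite /fpow v0 mulrA -cpowD (_ : 2 - s - 1 + (s - 1) = 0) ?cpow0 ?mul1r //.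
  by ring.
have mi : cmeasurable i.
  have := cmeasurable_affine (2 * T) (-1) (cmeasurable_fpow (2 - s)).
  rewrite (_ : (fun x => fpow (2 - s) (-1 * x + 2 * T)) = fun u => fpow (2 - s) (2 * T - u)); last first.
    by apply/funext => u; rewrite mulN1r [- u + _]addrC.
  move=> mf; have := cmeasurableM (cmeasurable_real (f := fun u : R => if u < T then 1 else 0) _) mf.
  rewrite /i => h; have : cmeasurable (fun u => (if u < T then 1 else 0)%:C * fpow (2 - s) (2 * T - u)).
    apply: h; apply: measurable_fun_ifT => //; exact: measurable_fun_ltr.
  congr cmeasurable; apply/funext => u; case: ifP => _; [exact: mul1r|exact: mul0r].
(* For [0 < u < T] the base [2 T - u] lies in ]T, 2T[; the sign of [1 - Re s] decides which end
   gives the larger power, and [C] adds both. *)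
pose C := 2 * (T `^ (1 - Re s) + (2 * T) `^ (1 - Re s)).
apply: (eq_cintegrable E).
apply: (le_cintegrable (g := fun u => C * norm1 (fpow s (2 * T - u) * M u))).
- by apply: cmeasurableM => //; exact: cintegrable_cmeasurable.
- by have := integrableZl measurableT C (cintegrable_norm1 iM); apply: eq_integrable.
- move=> u; rewrite (le_trans (norm1M _ _)) //.
  have [u0|u0] := leP u 0; first by rewrite Mneg // mulr0 norm10 !mulr0.
  rewrite ler_wpM2r ?norm1_ge0 // /i /C; case: ifP => uT; last first.
    by rewrite norm10 mulr_ge0 ?addr_ge0 ?powR_ge0.
  rewrite (le_trans (norm1_fpow _ _)) // ler_wpM2l //.
  have v0 : 0 < 2 * T - u by lra.
  rewrite /rfpow v0 (_ : Re (2 - s) - 1 = 1 - Re s); last by case: (s) => a c /=; ring.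
  have [r0|r0] := leP 0 (1 - Re s).
    by rewrite -[leLHS]add0r lerD ?powR_ge0 // ge0_ler_powR // ?nnegrE; lra.
  rewrite -[leLHS]addr0 lerD ?powR_ge0 // -[1 - Re s]opprK !(powRN _ (- (1 - Re s))).
  rewrite lef_pV2 ?posrE ?powR_gt0 // ge0_ler_powR // ?nnegrE; lra.
Qed.

(** There is at least one kernel: the one of order [s], taken at [2 T], provides the integrability
    of [M] on ]0, T[. *)
Lemma volterra_unique n (c : nat -> R[i]) s (M : R -> R[i]) : 0 < Re s ->
  (forall u, u <= 0 -> M u = 0) ->
  (forall t, 0 < t -> (forall r, (r < n.+1)%N ->
     cintegrable setT (fun u => fpow (r.+1%:R * s) (t - u) * M u)) /\
     M t = \sum_(r < n.+1) c r * cconv (fpow (r.+1%:R * s)) M t) ->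
  forall t, M t = 0.
Proof.
move=> s0 Mneg HM t1; have [t0|t1_gt0] := leP t1 0; first exact: Mneg.
pose T := t1 + 1; have T0 : 0 < T by rewrite addr_gt0.
have rs0 r : 0 < Re (r.+1%:R * s) by rewrite mulrC Re_mulr_natr mulr_gt0.
pose g u := norm1 (if u < T then M u else 0).
have gi : mu.-integrable setT (EFin \o g).
  apply: cintegrable_norm1; apply: truncated_cintegrable => //.
  have T2 : 0 < 2 * T by rewrite mulr_gt0.
  have := (HM _ T2).1 0%N (ltn0Sn n); rewrite mul1r; exact.
have g0 u : 0 <= g u by exact: norm1_ge0.
have mg : measurable_fun setT g by apply/measurable_EFinP; exact: measurable_int gi.
(* Truncation makes the kernel integrable. For [t < T] it changes nothing, since [M] lives on
   [u > 0], where [t - u < T]. *)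
pose kr (r : nat) x := if x < T then norm1 (c r) * norm1 (fpow (r.+1%:R * s) x) else 0.
have kr0 r x : 0 <= kr r x by rewrite /kr; case: ifP => // _; rewrite mulr_ge0 ?norm1_ge0.
have mkr r : measurable_fun setT (kr r).
  apply: measurable_fun_ifT => //; first exact: measurable_fun_ltr.
  by apply: measurable_funM => //; exact: cmeasurable_norm1 (cmeasurable_fpow _).
have ikr r : mu.-integrable setT (EFin \o kr r).
  have I := integrableZl measurableT (norm1 (c r) * 2) (integrable_rfpow_trunc T (rs0 r)).
  apply: (le_integrable _ _ _ I) => //; first by apply/measurable_EFinP; exact: mkr.
  move=> x _ /=; rewrite lee_fin ger0_norm // (le_trans _ (ler_norm _)) // /kr.
  case: ifP => xT; last by rewrite mulr0.
  by rewrite -mulrA ler_wpM2l ?norm1_ge0 // norm1_fpow.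
pose K x := \sum_(r < n.+1) kr r x.
have K0 x : 0 <= K x by exact: sumr_ge0.
have mK : measurable_fun setT K by apply: measurable_sum.
have iK : mu.-integrable setT (EFin \o K).
  have := integrable_sum (mu := mu) measurableT (P := predT)
    (h := fun r : 'I_n.+1 => EFin \o kr r) (index_enum 'I_n.+1) (fun r _ => ikr r).
  by apply: eq_integrable => // x _ /=; rewrite sumEFin.
have Kneg x : x <= 0 -> K x = 0.
  move=> x0; rewrite /K big1 // => r _; rewrite /kr /fpow [0 < x]ltNge x0 /= norm10 mulr0.
  by case: ifP.
have [m Lm] := laplace_small mK K0 Kneg iK.
pose e (x : R) := expR (- (m%:R * x)).
have me : measurable_fun setT e.
  by apply: measurableT_comp => //; apply: measurableT_comp => //; exact: measurable_funM.
have e0 x : 0 <= e x by exact: expR_ge0.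
suff : ((e t1 * g t1)%:E = 0)%E.
  move=> [] /eqP; rewrite mulf_eq0 gt_eqF ?expR_gt0 //= /g ltrDl ltr01 => /eqP h.
  by apply: norm1_eq0; rewrite h.
apply: (@conv_subinvariant_eq0 (fun x => (e x * K x)%:E) (fun x => (e x * g x)%:E)) => //.
- by apply/measurable_EFinP; exact: measurable_funM.
- by apply/measurable_EFinP; exact: measurable_funM.
- by move=> x; rewrite lee_fin mulr_ge0.
- by move=> x; rewrite lee_fin mulr_ge0.
- have := integrable_fin_num measurableT gi; rewrite fin_numE => /andP[_]; rewrite -ltey.
  apply: le_lt_trans; apply: ge0_le_integral => //.
  + by move=> x _; rewrite lee_fin mulr_ge0.
  + by apply/measurable_EFinP; exact: measurable_funM.
  + exact/measurable_EFinP.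
  + move=> x _; rewrite lee_fin; have [x0|x0] := leP x 0.
      by rewrite /g Mneg // if_same norm10 mulr0.
    by rewrite ler_piMl // expR_le1 oppr_le0 mulr_ge0 // ltW.
move=> t.
have [tT|Tt] := ltP t T; last first.
  rewrite /g ltNge Tt /= norm10 mulr0; apply: integral_ge0 => u _.
  by apply: mule_ge0; rewrite lee_fin mulr_ge0 ?norm1_ge0.
have [tneg|t0] := leP t 0.
  rewrite /g Mneg // if_same norm10 mulr0; apply: integral_ge0 => u _.
  by apply: mule_ge0; rewrite lee_fin mulr_ge0 ?norm1_ge0.
(* The weight is multiplicative, [e (t - u) * e u = e t], so it passes through the convolution. *)
have -> : (\int[mu]_u ((e (t - u) * K (t - u))%:E * (e u * g u)%:E) =
    (e t)%:E * \int[mu]_u (K (t - u) * g u)%:E)%E.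
  rewrite -ge0_integralZl //.
  - apply: eq_integral => u _; rewrite -!EFinM; congr EFin.
    by rewrite mulrACA /e -expRD; congr (expR _ * _); ring.
  - apply/measurable_EFinP; apply: measurable_funM => //.
    by apply: (measurableT_comp mK); exact: measurable_funB.
  - by move=> u _; rewrite lee_fin mulr_ge0.
  - by rewrite lee_fin.
rewrite EFinM lee_pmul2l ?lte_fin ?expR_gt0 //.
have [HI HE] := HM t t0.
rewrite {1}/g tT HE.
have mrt r : measurable_fun setT (fun u : R => (kr r (t - u) * g u)%:E).
  apply/measurable_EFinP; apply: measurable_funM => //.
  by apply: (measurableT_comp (mkr r)); exact: measurable_funB.
have -> : (\int[mu]_u (K (t - u) * g u)%:E = \sum_(r < n.+1) \int[mu]_u (kr r (t - u) * g u)%:E)%E.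
  rewrite -ge0_integral_sum //; first last.
  - by move=> r u _; rewrite lee_fin mulr_ge0.
  - by move=> r; exact: mrt.
  by apply: eq_integral => u _; rewrite /K mulr_suml sumEFin.
apply: (@le_trans _ _ (\sum_(r < n.+1) (norm1 (c r * cconv (fpow (r.+1%:R * s)) M t))%:E)%E).
  rewrite sumEFin lee_fin; elim/big_rec2: _ => [|r x y _ xy]; first by rewrite norm10.
  by rewrite (le_trans (norm1D _ _)) // lerD2l.
apply: lee_sum => r _; have ir := HI r (ltn_ord r).
apply: (@le_trans _ _ ((norm1 (c r))%:E * (\int[mu]_u norm1 (fpow (r.+1%:R * s) (t - u) * M u))%:E)%E).
  rewrite -EFinM lee_fin (le_trans (norm1M _ _)) // ler_wpM2l ?norm1_ge0 //.
  exact: norm1_cintegral.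
have inr := cintegrable_norm1 ir.
rewrite /Rintegral fineK; last exact: (integrable_fin_num measurableT inr).
rewrite -ge0_integralZl //; last 3 first.
- exact: measurable_int inr.
- by move=> u _; rewrite lee_fin norm1_ge0.
- by rewrite lee_fin norm1_ge0.
apply: ge0_le_integral => //.
- by move=> u _; rewrite -EFinM lee_fin mulr_ge0 ?norm1_ge0.
- by apply: measurable_funeM; exact: measurable_int inr.
- exact: mrt.
- move=> u _; rewrite -EFinM lee_fin.
  have [u0|u0] := leP u 0; first by rewrite Mneg // mulr0 norm10 mulr0 mulr_ge0.
  have [ut|tu] := ltP u t; last first.
    by rewrite /fpow subr_gt0 ltNge tu /= mul0r norm10 mulr0 mulr_ge0.
  rewrite /kr (_ : t - u < T); last by lra.
  by rewrite /g (lt_trans ut tT) -mulrA ler_wpM2l ?norm1_ge0 // norm1M.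
Qed.

Lemma ckinetic_solution_unique s tau delta (p : R) (N0 : R[i]) n (N1 N2 : R -> R[i]) :
  0 < Re s ->
  ckinetic_solution s tau delta p N0 n N1 -> ckinetic_solution s tau delta p N0 n N2 ->
  forall t, 0 < t -> N1 t = N2 t.
Proof.
move=> s0 H1 H2 t t0.
(* For [n = 0] the sum is empty and the equation itself determines the solution; [volterra_unique]
   takes over from one kernel on. *)
case: n H1 H2 => [|n] H1 H2.
  have [_] := H1 t t0; have [_] := H2 t t0; rewrite !big_geq // !oppr0.
  by move=> /subr0_eq -> /subr0_eq ->.
pose cut (N : R -> R[i]) u := if 0 < u then N u else 0.
have cutE N u : cut N u = if 0 < u then N u else 0 by [].
have int N : ckinetic_solution s tau delta p N0 n.+1 N -> forall t, 0 < t ->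
    forall r, (r < n.+1)%N -> cintegrable setT (fun u => fpow (r.+1%:R * s) (t - u) * cut N u).
  move=> HN x x0 r rn; have [/(_ r.+1 rn) + _] := HN x x0.
  by move/(cintegrable_mkcond _ (measurable_itv _)); rewrite (RL_kernelE _ _ (cutE N)).
have eqn N : ckinetic_solution s tau delta p N0 n.+1 N -> forall t, 0 < t ->
    cut N t = ckinetic_term s tau delta p N0 t +
      \sum_(r < n.+1) - ('C(n.+1, r.+1)%:R * cpow p (r.+1%:R * s) / cGamma (r.+1%:R * s)) *
        cconv (fpow (r.+1%:R * s)) (cut N) t.
  move=> HN x x0; have [_ /(canRL (subrK _)) E] := HN x x0.
  rewrite /cut x0 E addrC; congr (_ + _); rewrite big_add1 big_mkord /= -sumrN.
  apply: eq_bigr => r _; rewrite cintegral_mkcond (RL_kernelE _ _ (cutE N)).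
  by rewrite mulNr mulrA.
pose M u := cut N1 u + (-1) * cut N2 u.
suff : M t = 0.
  by rewrite /M /cut t0 mulN1r => /subr0_eq.
have convM r x u : fpow (r.+1%:R * s) (x - u) * M u =
    fpow (r.+1%:R * s) (x - u) * cut N1 u + (-1) * (fpow (r.+1%:R * s) (x - u) * cut N2 u).
  by rewrite /M; ring.
apply: (@volterra_unique n
  (fun r => - ('C(n.+1, r.+1)%:R * cpow p (r.+1%:R * s) / cGamma (r.+1%:R * s))) s M s0).
  by move=> u u0; rewrite /M /cut ltNge u0 /= mulr0 addr0.
move=> x x0; have i1 := int N1 H1 x x0; have i2 := int N2 H2 x x0; split.
  move=> r rn; apply: (eq_cintegrable (fun u => esym (convM r x u))).
  by apply: cintegrableD; [exact: i1|apply: cintegrableZl; exact: i2].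
rewrite {1}/M (eqn N1 H1 x x0) (eqn N2 H2 x x0) mulN1r opprD addrACA subrr add0r.
rewrite -sumrB; apply: eq_bigr => r _; rewrite -mulrBr; congr (_ * _).
have j1 := i1 r (ltn_ord r); have j2 := i2 r (ltn_ord r).
rewrite /cconv (eq_cintegral (fun u _ => convM r x u)) cintegralD //; last exact: cintegrableZl.
by rewrite cintegralZl // mulN1r.
Qed.

End Uniqueness.

(** * Idempotent components *)

Section Components.
Variable R : realType.
Notation T := (bicomplex R).
Notation Re := (@complex.Re R).
Notation Im := (@complex.Im R).
Implicit Types (x y sigma tau delta a nu : T).

(** With [idem1M] this makes the component a ring morphism, so sums, products, numerals and inverses
    of units pass through it. *)
Lemma idem1_is_zmod_morphism : zmod_morphism (@idem1 R).
Proof. by move=> [a b] [c d]; rewrite /idem1 /=; ring. Qed.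

Lemma idem2_is_zmod_morphism : zmod_morphism (@idem2 R).
Proof. by move=> [a b] [c d]; rewrite /idem2 /=; ring. Qed.

HB.instance Definition _ :=
  GRing.isZmodMorphism.Build T R[i] (@idem1 R) idem1_is_zmod_morphism.
HB.instance Definition _ :=
  GRing.isMonoidMorphism.Build T R[i] (@idem1 R) (idem1_1 R, @idem1M R).
HB.instance Definition _ :=
  GRing.isZmodMorphism.Build T R[i] (@idem2 R) idem2_is_zmod_morphism.
HB.instance Definition _ :=
  GRing.isMonoidMorphism.Build T R[i] (@idem2 R) (idem2_1 R, @idem2M R).

Lemma idem1D x y : idem1 (x + y) = idem1 x + idem1 y. Proof. exact: rmorphD. Qed.
Lemma idem2D x y : idem2 (x + y) = idem2 x + idem2 y. Proof. exact: rmorphD. Qed.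
Lemma idem1N x : idem1 (- x) = - idem1 x. Proof. exact: rmorphN. Qed.
Lemma idem2N x : idem2 (- x) = - idem2 x. Proof. exact: rmorphN. Qed.
Lemma idem1_nat k : idem1 (k%:R : T) = k%:R. Proof. exact: rmorph_nat. Qed.
Lemma idem2_nat k : idem2 (k%:R : T) = k%:R. Proof. exact: rmorph_nat. Qed.
Lemma idem1X x k : idem1 (x ^+ k) = idem1 x ^+ k. Proof. exact: rmorphXn. Qed.
Lemma idem2X x k : idem2 (x ^+ k) = idem2 x ^+ k. Proof. exact: rmorphXn. Qed.
Lemma idem1V x : x \is a GRing.unit -> idem1 x^-1 = (idem1 x)^-1.
Proof. exact: rmorphV. Qed.
Lemma idem2V x : x \is a GRing.unit -> idem2 x^-1 = (idem2 x)^-1.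
Proof. exact: rmorphV. Qed.

Definition idemE := (idem1D, idem2D, idem1N, idem2N, idem1M, idem2M, idem1X, idem2X,
  idem1_nat, idem2_nat, idem1_1, idem2_1, of_idemK1, of_idemK2).

Lemma bicomplex_unitE x : (x \is a GRing.unit) = (idem1 x != 0) && (idem2 x != 0).
Proof. by []. Qed.

Lemma Re_idem1 x : Re (idem1 x) = bcRe x + bcImj x.
Proof. by case: x => -[a b] [c d]; rewrite /idem1 /bcRe /bcImj /=; ring. Qed.

Lemma Re_idem2 x : Re (idem2 x) = bcRe x - bcImj x.
Proof. by case: x => -[a b] [c d]; rewrite /idem2 /bcRe /bcImj /=; ring. Qed.

(** The real parts of the components are [bcRe x] plus and minus [bcImj x]: the hypothesis places
    both components in the open right half-plane. *)
Lemma Re_idem_gt0 x : `|bcImj x| < bcRe x -> 0 < Re (idem1 x) /\ 0 < Re (idem2 x).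
Proof. by rewrite Re_idem1 Re_idem2 ltr_norml => /andP[? ?]; split; lra. Qed.

Lemma idem1_real (r : R) : idem1 (bc_real r) = r%:C.
Proof. by rewrite /idem1 /= mulr0 subr0. Qed.

Lemma idem2_real (r : R) : idem2 (bc_real r) = r%:C.
Proof. by rewrite /idem2 /= mulr0 addr0. Qed.

Lemma Re_mulC (z : R[i]) (r : R) : Re (z * r%:C) = Re z * r.
Proof. by case: z => a b /=; rewrite mulr0 subr0. Qed.

(** Limits are componentwise by definition, inverses only on units; each denominator is a unit
    because Gamma vanishes in neither component. *)
Lemma idem_prabhakar sigma tau delta zeta :
  0 < Re (idem1 sigma) -> 0 < Re (idem2 sigma) ->
  0 < Re (idem1 tau) -> 0 < Re (idem2 tau) ->
  idem1 (prabhakar sigma tau delta zeta) =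
    cprabhakar (idem1 sigma) (idem1 tau) (idem1 delta) (idem1 zeta) /\
  idem2 (prabhakar sigma tau delta zeta) =
    cprabhakar (idem2 sigma) (idem2 tau) (idem2 delta) (idem2 zeta).
Proof.
move=> s1 s2 t1 t2.
have g1 k : cGamma (idem1 (sigma * k%:R + tau)) != 0.
  by apply: cGamma_neq0; rewrite !idemE; exact: Re_gt0_affine.
have g2 k : cGamma (idem2 (sigma * k%:R + tau)) != 0.
  by apply: cGamma_neq0; rewrite !idemE; exact: Re_gt0_affine.
have f0 k : k`!%:R != 0 :> R[i] by rewrite pnatr_eq0 -lt0n fact_gt0.
have u k : k`!%:R * bcGamma (sigma * k%:R + tau) \is a GRing.unit.
  by rewrite bicomplex_unitE !(idem1M, idem2M, idem1_nat, idem2_nat, of_idemK1, of_idemK2) !mulf_neq0.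
rewrite /prabhakar /bclim of_idemK1 of_idemK2.
split; congr clim; apply/funext => n.
- rewrite [LHS]rmorph_sum; apply: eq_bigr => k _ /=.
  rewrite !idem1M idem1X (idem1V (u k)) !idemE; congr (_ / _ * _).
  by rewrite [LHS]rmorph_prod; apply: eq_bigr => i _ /=; rewrite !idemE.
- rewrite [LHS]rmorph_sum; apply: eq_bigr => k _ /=.
  rewrite !idem2M idem2X (idem2V (u k)) !idemE; congr (_ / _ * _).
  by rewrite [LHS]rmorph_prod; apply: eq_bigr => i _ /=; rewrite !idemE.
Qed.

Lemma idem_kinetic_term sigma tau delta a (N0 : T) (t : R) :
  0 < Re (idem1 sigma) -> 0 < Re (idem2 sigma) ->
  0 < Re (idem1 tau) -> 0 < Re (idem2 tau) ->
  idem1 (kinetic_term sigma tau delta a N0 t) =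
    ckinetic_term (idem1 sigma) (idem1 tau) (idem1 delta) (Re (idem1 a)) (idem1 N0) t /\
  idem2 (kinetic_term sigma tau delta a N0 t) =
    ckinetic_term (idem2 sigma) (idem2 tau) (idem2 delta) (Re (idem2 a)) (idem2 N0) t.
Proof.
move=> s1 s2 t1 t2; rewrite /kinetic_term !idem1M !idem2M.
have [-> ->] := idem_prabhakar delta (- bcpow (a * bc_real t) sigma) s1 s2 t1 t2.
by rewrite !idemE idem1_real idem2_real !Re_mulC.
Qed.

Lemma idem_RL_kernel nu (N : R -> T) (t u : R) :
  idem1 (RL_kernel nu N t u) = cpow (t - u) (idem1 nu - 1) * idem1 (N u) /\
  idem2 (RL_kernel nu N t u) = cpow (t - u) (idem2 nu - 1) * idem2 (N u).
Proof.
by rewrite /RL_kernel /bcpow !idemE idem1_real idem2_real.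
Qed.

Lemma idem_RL_integral nu (N : R -> T) (t : R) :
  0 < Re (idem1 nu) -> 0 < Re (idem2 nu) ->
  idem1 (RL_integral nu N t) = (cGamma (idem1 nu))^-1 *
    cintegral `]0, t[ (fun u => cpow (t - u) (idem1 nu - 1) * idem1 (N u)) /\
  idem2 (RL_integral nu N t) = (cGamma (idem2 nu))^-1 *
    cintegral `]0, t[ (fun u => cpow (t - u) (idem2 nu - 1) * idem2 (N u)).
Proof.
move=> n1 n2; rewrite /RL_integral /bcintegral !idemE.
have u : bcGamma nu \is a GRing.unit.
  by rewrite bicomplex_unitE of_idemK1 of_idemK2 !cGamma_neq0.
rewrite (idem1V u) (idem2V u) !idemE.
by split; congr (_ * _); apply: eq_cintegral => x _; have [] := idem_RL_kernel nu N t x.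
Qed.

(** An equivalence, because existence is lifted from the components while uniqueness is pushed down
    to them. *)
Lemma kinetic_solution_idem sigma tau delta a (N0 : T) n (N : R -> T) :
  0 < Re (idem1 sigma) -> 0 < Re (idem2 sigma) ->
  0 < Re (idem1 tau) -> 0 < Re (idem2 tau) ->
  kinetic_solution sigma tau delta a N0 n N <->
  ckinetic_solution (idem1 sigma) (idem1 tau) (idem1 delta) (Re (idem1 a)) (idem1 N0) n
    (fun t => idem1 (N t)) /\
  ckinetic_solution (idem2 sigma) (idem2 tau) (idem2 delta) (Re (idem2 a)) (idem2 N0) n
    (fun t => idem2 (N t)).
Proof.
move=> s1 s2 t1 t2.
have r1 r : idem1 (r%:R * sigma) = r%:R * idem1 sigma by rewrite !idemE.
have r2 r : idem2 (r%:R * sigma) = r%:R * idem2 sigma by rewrite !idemE.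
have intE r t : RL_integrable (r%:R * sigma) N t <->
    cintegrable `]0, t[ (fun u => cpow (t - u) (r%:R * idem1 sigma - 1) * idem1 (N u)) /\
    cintegrable `]0, t[ (fun u => cpow (t - u) (r%:R * idem2 sigma - 1) * idem2 (N u)).
  rewrite /RL_integrable /bcintegrable -r1 -r2.
  rewrite (_ : (fun u => idem1 _) = fun u => cpow (t - u) (idem1 (r%:R * sigma) - 1) * idem1 (N u)); last first.
    by apply/funext => u; have [] := idem_RL_kernel (r%:R * sigma) N t u.
  rewrite (_ : (fun u => idem2 _) = fun u => cpow (t - u) (idem2 (r%:R * sigma) - 1) * idem2 (N u)) //.
  by apply/funext => u; have [] := idem_RL_kernel (r%:R * sigma) N t u.
have sumE t :
  idem1 (- \sum_(1 <= r < n.+1) 'C(n, r)%:R * bcpow a (r%:R * sigma) * RL_integral (r%:R * sigma) N t) =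
  - \sum_(1 <= r < n.+1) 'C(n, r)%:R * cpow (Re (idem1 a)) (r%:R * idem1 sigma) *
    ((cGamma (r%:R * idem1 sigma))^-1 *
      cintegral `]0, t[ (fun u => cpow (t - u) (r%:R * idem1 sigma - 1) * idem1 (N u))) /\
  idem2 (- \sum_(1 <= r < n.+1) 'C(n, r)%:R * bcpow a (r%:R * sigma) * RL_integral (r%:R * sigma) N t) =
  - \sum_(1 <= r < n.+1) 'C(n, r)%:R * cpow (Re (idem2 a)) (r%:R * idem2 sigma) *
    ((cGamma (r%:R * idem2 sigma))^-1 *
      cintegral `]0, t[ (fun u => cpow (t - u) (r%:R * idem2 sigma - 1) * idem2 (N u))).
  have g1 r : (0 < r)%N -> 0 < Re (idem1 (r%:R * sigma)).
    by move=> r0; rewrite r1 mulrC Re_mulr_natr mulr_gt0 // ltr0n.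
  have g2 r : (0 < r)%N -> 0 < Re (idem2 (r%:R * sigma)).
    by move=> r0; rewrite r2 mulrC Re_mulr_natr mulr_gt0 // ltr0n.
  rewrite idem1N idem2N; split; congr (- _).
  - rewrite [LHS]rmorph_sum !big_nat; apply: eq_bigr => r /andP[r0 _].
    have [E _] := idem_RL_integral N t (g1 r r0) (g2 r r0).
    by rewrite /= (idem1M ('C(n, r)%:R * _)) (idem1M 'C(n, r)%:R) E idem1_nat of_idemK1 r1.
  - rewrite [LHS]rmorph_sum !big_nat; apply: eq_bigr => r /andP[r0 _].
    have [_ E] := idem_RL_integral N t (g1 r r0) (g2 r r0).
    by rewrite /= (idem2M ('C(n, r)%:R * _)) (idem2M 'C(n, r)%:R) E idem2_nat of_idemK2 r2.
split=> [H|[H1 H2] t t0].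
  split=> t t0; have [I E] := H t t0; split.
  - by move=> r rn; have /intE[] := I r rn.
  - have [<- _] := sumE t; rewrite -E idem1D idem1N.
    by have [-> _] := idem_kinetic_term delta a N0 t s1 s2 t1 t2.
  - by move=> r rn; have /intE[] := I r rn.
  - have [_ <-] := sumE t; rewrite -E idem2D idem2N.
    by have [_ ->] := idem_kinetic_term delta a N0 t s1 s2 t1 t2.
have [I1 E1] := H1 t t0; have [I2 E2] := H2 t t0; split.
  by move=> r rn; apply/intE; split; [exact: I1|exact: I2].
have [K1 K2] := idem_kinetic_term delta a N0 t s1 s2 t1 t2.
have [S1 S2] := sumE t.
apply: idem_inj.
- by rewrite idem1D idem1N K1; exact: etrans E1 (esym S1).
- by rewrite idem2D idem2N K2; exact: etrans E2 (esym S2).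
Qed.

End Components.

Theorem theorem5p2 (R : realType) (sigma tau delta : bicomplex R)
    (u1 u4 : R) (N0 : bicomplex R) (n : nat)
    (hsigma : `|bcImj sigma| < bcRe sigma)
    (htau : `|bcImj tau| < bcRe tau)
    (ha : `|u4| < u1) :
  let a := hyperbolic u1 u4 in
  let sol := kinetic_term sigma tau (delta + n%:R) a N0 in
  kinetic_solution sigma tau delta a N0 n sol /\
  (forall N : R -> bicomplex R,
     kinetic_solution sigma tau delta a N0 n N ->
     forall t : R, 0 < t -> N t = sol t).
Proof.
have [s1 s2] := Re_idem_gt0 hsigma; have [t1 t2] := Re_idem_gt0 htau.
move=> a sol.
have a1 : 0 < complex.Re (idem1 a).
  by rewrite idem1_hyperbolic /=; move: ha; rewrite ltr_norml => /andP[]; lra.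
have a2 : 0 < complex.Re (idem2 a).
  by rewrite idem2_hyperbolic /=; move: ha; rewrite ltr_norml => /andP[]; lra.
have D1 : idem1 (delta + n%:R) = idem1 delta + n%:R by rewrite idem1D idem1_nat.
have D2 : idem2 (delta + n%:R) = idem2 delta + n%:R by rewrite idem2D idem2_nat.
have solE t := idem_kinetic_term (delta + n%:R) a N0 t s1 s2 t1 t2.
rewrite D1 D2 in solE.
have E1 : (fun t => idem1 (sol t)) = ckinetic_term (idem1 sigma) (idem1 tau)
    (idem1 delta + n%:R) (complex.Re (idem1 a)) (idem1 N0).
  by apply/funext => t; have [e _] := solE t; exact: e.
have E2 : (fun t => idem2 (sol t)) = ckinetic_term (idem2 sigma) (idem2 tau)
    (idem2 delta + n%:R) (complex.Re (idem2 a)) (idem2 N0).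
  by apply/funext => t; have [_ e] := solE t; exact: e.
have Hsol : kinetic_solution sigma tau delta a N0 n sol.
  apply/kinetic_solution_idem => //; rewrite E1 E2.
  by split; exact: ckinetic_solution_exists.
split=> // N /(kinetic_solution_idem _ _ _ _ _ s1 s2 t1 t2)[N1 N2] t t0.
have /(kinetic_solution_idem _ _ _ _ _ s1 s2 t1 t2)[S1 S2] := Hsol.
apply: idem_inj.
- exact: (ckinetic_solution_unique s1 N1 S1 t0).
- exact: (ckinetic_solution_unique s2 N2 S2 t0).
Qed.
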